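(* Let $P=\mathcal N(0,I_d)$ and $Q=\mathcal N(\mu,I_d)$ on $\mathbb R^d$, let $\kappa$ be the RBF kernel with bandwidth $\gamma$, and let $\rho_d$ be the moment ratio of $u^{\mathrm{MMD}}$. Assume $\gamma=\omega(1)$ and $\|\mu\|_2^2=\Omega(1)$. If $\gamma=o(\|\mu\|_2^2)$ and $\gamma=o(d^{1/2})$, then $\rho_d=\Theta\big(\exp\big(\frac{3d}{4\gamma^2}+o(\frac d{\gamma^2})\big)\big)$. If instead $\gamma=\omega(\|\mu\|_2^2)$, then: (i) for $\gamma=o(d^{1/2})$, $\rho_d=\Theta\Big(\frac{\gamma}{\|\mu\|_2^2}\exp\big(\frac{3d}{4\gamma^2}+o(\frac d{\gamma^2})\big)\Big)$; (ii) for $\gamma=\omega(d^{1/2})$, $\rho_d=\Theta\Big(\frac{\|\mu\|_2+d^{1/2}}{\|\mu\|_2+\gamma^{-1}d^{1/2}\|\mu\|_2^2}\Big)$; (iii) for $\gamma=\Theta(d^{1/2})$, $\rho_d=O\Big(\frac{d^{1/2}}{\|\mu\|_2^2}\Big)$.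
   Context: Here $d=d_n\in\mathbb N$, $\gamma=\gamma_n>0$ and $\mu=\mu_n\in\mathbb R^{d_n}$ vary with $n$, and $o,O,\Theta,\omega,\Omega$ are the usual asymptotic notations as $n\to\infty$. RBF kernel: $\kappa(\mathbf x,\mathbf x')=\exp(-\|\mathbf x-\mathbf x'\|_2^2/(2\gamma))$. For $\mathbf z=(\mathbf x,\mathbf y),\mathbf z'=(\mathbf x',\mathbf y')\in\mathbb R^{2d}$, $u^{\mathrm{MMD}}(\mathbf z,\mathbf z')=\kappa(\mathbf x,\mathbf x')+\kappa(\mathbf y,\mathbf y')-\kappa(\mathbf x,\mathbf y')-\kappa(\mathbf x',\mathbf y)$. For $\mathbf Z_i=(\mathbf X_i,\mathbf Y_i)$, $i=1,2$, with $\mathbf X_1,\mathbf X_2\sim Q$, $\mathbf Y_1,\mathbf Y_2\sim P$ all independent: $\rho_d=\sigma_{\mathrm{full}}/\sigma_{\mathrm{cond}}$ with $\sigma_{\mathrm{full}}=\sqrt{\mathrm{Var}[u^{\mathrm{MMD}}(\mathbf Z_1,\mathbf Z_2)]}$ and $\sigma_{\mathrm{cond}}=\sqrt{\mathrm{Var}\,\mathbb E[u^{\mathrm{MMD}}(\mathbf Z_1,\mathbf Z_2)|\mathbf Z_1]}$. *)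

(* Defs.v *)
From HB Require Import structures.
From mathcomp Require Import all_boot all_order all_algebra.
From mathcomp Require Import all_classical all_reals all_analysis.

Set Implicit Arguments.
Unset Strict Implicit.
Unset Printing Implicit Defensive.

Import Order.TTheory GRing.Theory Num.Theory.
Import numFieldNormedType.Exports.

Local Open Scope classical_set_scope.
Local Open Scope ring_scope.

(* Points of R^d are d-tuples, since these carry the product sigma-algebra in
   the library (row vectors carry none, and their library norm is the sup
   norm). *)

Definition norm2 (R : realType) (d : nat) (x : d.-tuple R) : R :=
  Num.sqrt (\sum_(i < d) tnth x i ^+ 2).

Definition subt (R : realType) (d : nat) (x y : d.-tuple R) : d.-tuple R :=
  [tuple tnth x i - tnth y i | i < d].

Definition zerot (R : realType) (d : nat) : d.-tuple R := [tuple 0 | _ < d].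

Section gaussian.
Context {R : realType}.

(* The library's normal laws live on measurableTypeR R, which is R with the
   same (Borel) sigma-algebra under a different display. *)
Definition ctuple (n : nat) (x : measurableTypeR R * n.-tuple R) :
  n.+1.-tuple R := [the n.+1.-tuple R of (x.1 : R) :: x.2].

Lemma measurable_ctuple (n : nat) : measurable_fun [set: _] (@ctuple n).
Proof.
apply: measurable_cons; last exact: measurable_snd.
have mid : measurable_fun [set: measurableTypeR R] (idfun : _ -> R).
  by move=> _ A mA; rewrite setTI.
exact: (measurableT_comp mid measurable_fst).
Qed.

HB.instance Definition _ (n : nat) :=
  isMeasurableFun.Build _ _ _ _ (@ctuple n) (@measurable_ctuple n).

Section product.
Context d1 d2 (T1 : measurableType d1) (T2 : measurableType d2).
Variables (P1 : probability T1 R) (P2 : probability T2 R).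

Definition prod_prob : set (T1 * T2) -> \bar R := (P1 \x P2)%E.

HB.instance Definition _ := Measure.on prod_prob.

Lemma prod_prob_setT : prod_prob [set: _] = 1%E.
Proof.
rewrite /prod_prob -setXTT product_measure1E//=.
by rewrite (@probability_setT _ _ _ P1) (@probability_setT _ _ _ P2) mule1.
Qed.

HB.instance Definition _ :=
  Measure_isProbability.Build _ _ _ prod_prob prod_prob_setT.

End product.

(* The product of the probability measures nu 0, ..., nu (n - 1). *)
Fixpoint tuple_prob (n : nat) : ('I_n -> probability (measurableTypeR R) R) ->
    probability (n.-tuple R) R :=
  match n with
  | 0 => fun _ => \d_ [tuple]
  | n'.+1 => fun nu =>
      distribution (prod_prob (nu ord0) (tuple_prob (fun i => nu (lift ord0 i))))
        (@ctuple n')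
  end.

(* N(mu, I_d) is the product of the one-dimensional laws N(mu_i, 1). *)
Definition gaussian (d : nat) (mu : d.-tuple R) : probability (d.-tuple R) R :=
  tuple_prob (fun i => normal_prob (tnth mu i) 1).

End gaussian.

Section probability_notions.
Context dO (Omega : measurableType dO) (R : realType) (Pr : probability Omega R).

Definition has_law dE (E : measurableType dE) (X : {RV Pr >-> E})
    (nu : probability E R) : Prop :=
  forall A : set E, measurable A -> distribution Pr X A = nu A.

Definition mutually_independent dE (E : measurableType dE) (I : finType)
    (X : I -> {RV Pr >-> E}) : Prop :=
  forall (J : {set I}) (A : I -> set E), (forall i, measurable (A i)) ->
    Pr (\bigcap_(i in [set` J]) (X i @^-1` A i)) =
    (\prod_(i in J) Pr (X i @^-1` A i))%E.

(* h is a version of E[X | Z], i.e., of E[X | sigma(Z)]. *)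
Definition is_cond_expectation dE (E : measurableType dE) (X : Omega -> R)
    (Z : Omega -> E) (h : Omega -> R) : Prop :=
  [/\ measurable_fun [set: g_sigma_algebra_preimageType Z]
        (h : g_sigma_algebra_preimageType Z -> R),
      Pr.-integrable [set: Omega] (EFin \o h) &
      forall A : set Omega, g_sigma_algebra_preimage Z A ->
        (\int[Pr]_(w in A) (h w)%:E = \int[Pr]_(w in A) (X w)%:E)%E].

(* Versions agree almost surely, so that the choice made by xget does not
   affect the moments. *)
Definition cond_expectation dE (E : measurableType dE) (X : Omega -> R)
    (Z : Omega -> E) : Omega -> R :=
  xget (cst 0) [set h | is_cond_expectation X Z h].

Section moment_ratio.
Context dE (E : measurableType dE).
Variables (u : E -> E -> R) (Z1 Z2 : Omega -> E).

Let U (w : Omega) : R := u (Z1 w) (Z2 w).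

Definition sigma_full : R := Num.sqrt (fine 'V_Pr[U]).

Definition sigma_cond : R := Num.sqrt (fine 'V_Pr[cond_expectation U Z1]).

Definition moment_ratio : R := sigma_full / sigma_cond.

End moment_ratio.

End probability_notions.

Section mmd.
Context {R : realType}.

Definition rbf (d : nat) (gamma : R) (x x' : d.-tuple R) : R :=
  expR (- (norm2 (subt x x') ^+ 2 / (2 * gamma))).

Definition u_MMD (d : nat) (kappa : d.-tuple R -> d.-tuple R -> R)
    (z z' : d.-tuple R * d.-tuple R) : R :=
  kappa z.1 z'.1 + kappa z.2 z'.2 - kappa z.1 z'.2 - kappa z'.1 z.2.

Definition is_mmd_sample (d : nat) (P Q : probability (d.-tuple R) R)
    dO (Omega : measurableType dO) (Pr : probability Omega R)
    (X1 X2 Y1 Y2 : {RV Pr >-> d.-tuple R}) : Prop :=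
  [/\ mutually_independent (tnth [tuple X1; X2; Y1; Y2]),
      has_law X1 Q /\ has_law X2 Q &
      has_law Y1 P /\ has_law Y2 P].

Definition rho_MMD (d : nat) (gamma : R)
    dO (Omega : measurableType dO) (Pr : probability Omega R)
    (X1 X2 Y1 Y2 : {RV Pr >-> d.-tuple R}) : R :=
  moment_ratio Pr (u_MMD (rbf gamma))
    (fun w => (X1 w, Y1 w)) (fun w => (X2 w, Y2 w)).

End mmd.

(* f = omega(g) as n tends to infinity; the library has no such notation. *)
Definition little_omega (R : realType) (f g : nat -> R) : Prop :=
  g =o_\oo f.

(* Main.v *)
Require Import Defs.
From HB Require Import structures.
From mathcomp Require Import all_boot all_order all_algebra.
From mathcomp Require Import all_classical all_reals all_analysis.
From mathcomp Require Import measurable_realfun ring lra.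

(** Everything is explicit. A Gaussian law smooths a Gaussian kernel of
    bandwidth s into one of bandwidth s + 1 ([mean_gaussian_rbf]), and a product
    of two kernels with a common argument is again a kernel in that argument
    ([rbf_mul]); hence the first two moments of u, and those of its conditional
    mean given Z1, are finite combinations of kernel values. Conditioning on Z1
    amounts to integrating out Z2 ([is_cond_expectation_mean]), since Z1 and Z2
    are independent with the same product law ([independent_pairs_law]).

    Write g for the bandwidth, m = |mu|^2, and
      A = (1 + 4 / (g (g + 4)))^(d/2),      B = (1 + 1 / ((g + 1) (g + 3)))^(d/2),
      e = exp (- m / (2 (g + 2))),  e3 = exp (- m / (g + 3)),
      e4 = exp (- m / (g + 4)),  X = exp (- m / (4 (g + 1)) - m / (4 (g + 3))).
    After the common factor 2 (g / (g + 2))^d has been cancelled, rho^2 = F / C with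
      F = A (1 + e4) - (1 + e^2) + 4 e - 4 B X,
      C = B (1 + e3 - 2 X) - (1 - e)^2
    ([rho_MMDE]). The large-dimension exponent is that of A / B, which is exactly
    (1 + 3 / (g (g + 4)))^(d/2) = exp (3 d / (2 g^2) + o (d / g^2)).

    The asymptotics come from the rewritings
      F = (A - 1) (1 + e4) - 4 (B - 1) X + (e4 - e^2) + 4 (e - X),
      C = (B - 1) K + (e3 - e^2) + 2 (e - X),   K = 1 + e3 - 2 X >= (1 - e)^2,
    in which e4 - e^2 and e3 - e^2 are of order m / g^2 when m <= g, and e - X is
    at most of that order. The terms are compared by means of B^3 <= A
    ([cond_excess_cube]).
    - If d / g^2 is large, then so are A and B, F is of order A, and C is of
      order B K. When m / g is large, K is of order 1 ([var_ratio_far]); when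
      m <= g and m is bounded below, K is of order (m / g)^2
      ([var_ratio_near]).
    - If d / g^2 is small, m <= g and m is bounded below, then A - 1 and B - 1 are
      of order d / g^2, so that F is of order (d + m) / g^2 and C of order
      (m + d m^2 / g^2) / g^2 ([var_ratio_wide]).
    - If d / g^2 stays between two positive constants and m <= g, then F is
      bounded and C is at least of order (m / g)^2 ([var_ratio_critical]). *)

Set Implicit Arguments.
Unset Strict Implicit.
Unset Printing Implicit Defensive.

Import Order.TTheory GRing.Theory Num.Theory.
Import numFieldNormedType.Exports.

Local Open Scope classical_set_scope.
Local Open Scope ring_scope.

(** * Bounded measurable functions and their means *)

Section bounded_measurable.
Context {R : realType}.

(** All functions averaged below are of this kind. The class is closed under the
    ring operations, under composition and under partial averaging, and its
    members are integrable against every probability measure. *)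
Definition bounded_measurable dT (T : measurableType dT) (f : T -> R) : Prop :=
  measurable_fun [set: T] f /\ exists C : R, forall x, `|f x| <= C.

Section closure.
Context dT (T : measurableType dT).
Implicit Types f g : T -> R.

Lemma bounded_measurable_cst (r : R) : bounded_measurable (fun _ : T => r).
Proof. by split; [exact: measurable_cst|exists `|r|]. Qed.

Lemma bounded_measurableD f g : bounded_measurable f -> bounded_measurable g ->
  bounded_measurable (fun x => f x + g x).
Proof.
move=> [mf [C fC]] [mg [D gD]]; split; first exact: measurable_funD.
by exists (C + D) => x; rewrite (le_trans (ler_normD _ _))// lerD.
Qed.

Lemma bounded_measurableB f g : bounded_measurable f -> bounded_measurable g ->
  bounded_measurable (fun x => f x - g x).
Proof.
move=> [mf [C fC]] [mg [D gD]]; split; first exact: measurable_funB.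
by exists (C + D) => x; rewrite (le_trans (ler_normB _ _))// lerD.
Qed.

Lemma bounded_measurableM f g : bounded_measurable f -> bounded_measurable g ->
  bounded_measurable (fun x => f x * g x).
Proof.
move=> [mf [C fC]] [mg [D gD]]; split; first exact: measurable_funM.
by exists (C * D) => x; rewrite normrM ler_pM.
Qed.

Lemma bounded_measurable_comp dS (S : measurableType dS) (h : S -> T) f :
  measurable_fun [set: S] h -> bounded_measurable f ->
  bounded_measurable (fun x => f (h x)).
Proof.
move=> mh [mf [C fC]]; split; first exact: measurableT_comp.
by exists C => x; exact: fC.
Qed.

End closure.

Section mean.
Context dT (T : measurableType dT) (m : probability T R).
Implicit Types f g : T -> R.

Lemma bounded_measurable_integrable f :
  bounded_measurable f -> m.-integrable [set: T] (EFin \o f).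
Proof.
move=> [mf [C fC]]; apply: measurable_bounded_integrable => //.
  by apply: (le_lt_trans (probability_le1 m measurableT)); rewrite ltry.
exists C; split; first exact: num_real.
by move=> r Cr x _ /=; rewrite (le_trans (fC x))// ltW.
Qed.

Lemma mean_cst (r : R) : \int[m]_(x in [set: T]) r = r.
Proof. by rewrite Rintegral_cst//= probability_setT mulr1. Qed.

Lemma meanD f g : bounded_measurable f -> bounded_measurable g ->
  \int[m]_x (f x + g x) = \int[m]_x f x + \int[m]_x g x.
Proof. by move=> bf bg; rewrite RintegralD//; exact: bounded_measurable_integrable. Qed.

Lemma meanB f g : bounded_measurable f -> bounded_measurable g ->
  \int[m]_x (f x - g x) = \int[m]_x f x - \int[m]_x g x.
Proof. by move=> bf bg; rewrite RintegralB//; exact: bounded_measurable_integrable. Qed.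

Lemma meanZl f r : bounded_measurable f ->
  \int[m]_x (r * f x) = r * \int[m]_x f x.
Proof. by move=> bf; rewrite RintegralZl//; exact: bounded_measurable_integrable. Qed.

Lemma meanZr f r : bounded_measurable f ->
  \int[m]_x (f x * r) = (\int[m]_x f x) * r.
Proof. by move=> bf; rewrite RintegralZr//; exact: bounded_measurable_integrable. Qed.

Lemma eq_mean f g : f =1 g -> \int[m]_x f x = \int[m]_x g x.
Proof. by move=> fg; congr Rintegral; exact/funext. Qed.

Lemma EFin_mean f : bounded_measurable f ->
  (\int[m]_x f x)%:E = (\int[m]_x (f x)%:E)%E.
Proof.
move=> bf; rewrite fineK//.
by apply: integrable_fin_num => //; exact: bounded_measurable_integrable.
Qed.

Lemma normr_mean_le f (C : R) : bounded_measurable f -> (forall x, `|f x| <= C) ->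
  `|\int[m]_x f x| <= C.
Proof.
move=> bf fC.
apply: (le_trans (le_normr_Rintegral _ (bounded_measurable_integrable bf))) => //.
rewrite -[leRHS]mean_cst; apply: le_Rintegral => //.
  by apply: integrable_norm; exact: bounded_measurable_integrable.
by apply: bounded_measurable_integrable; exact: bounded_measurable_cst.
Qed.

Lemma variance_mean f : bounded_measurable f ->
  fine 'V_m[f] = \int[m]_x f x ^+ 2 - (\int[m]_x f x) ^+ 2.
Proof.
move=> bf; set E := \int[m]_x f x.
have EE : fine 'E_m[f] = E by rewrite unlock.
rewrite /variance covariance.unlock EE expectation.unlock.
transitivity (\int[m]_x (f x ^+ 2 - (2 * E * f x - E ^+ 2))).
  by apply: eq_mean => x /=; rewrite !fctE /=; ring.
have bE : bounded_measurable (fun x => 2 * E * f x).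
  by apply: bounded_measurableM => //; exact: bounded_measurable_cst.
have bc := @bounded_measurable_cst _ T (E ^+ 2).
rewrite meanB//; last exact: bounded_measurableB.
- by rewrite meanB// meanZl// mean_cst -/E; ring.
- by under eq_fun do rewrite expr2; exact: bounded_measurableM.
Qed.

End mean.

Section product.
Context d1 d2 (T1 : measurableType d1) (T2 : measurableType d2).
Variables (m1 : probability T1 R) (m2 : probability T2 R).
Implicit Types f : T1 * T2 -> R.

Lemma bounded_measurable_mean2 f : bounded_measurable f ->
  bounded_measurable (fun x => \int[m2]_y f (x, y)).
Proof.
move=> bf; have [mf [C fC]] := bf; split; last first.
  exists C => x; apply: normr_mean_le => //.
  exact: (bounded_measurable_comp _ bf).
apply/measurable_EFinP.
rewrite (_ : _ \o _ = fubini_F m2 (EFin \o f)).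
  apply: (@measurable_fubini_F _ _ _ _ _ m1).
  exact: (bounded_measurable_integrable (prod_prob m1 m2) bf).
apply/funext => x; rewrite /fubini_F /= EFin_mean//.
exact: (bounded_measurable_comp _ bf).
Qed.

Lemma mean_prod f : bounded_measurable f ->
  \int[prod_prob m1 m2]_z f z = \int[m1]_x \int[m2]_y f (x, y).
Proof.
move=> bf; apply: EFin_inj.
rewrite !EFin_mean//; last exact: bounded_measurable_mean2.
rewrite -(@integral12_prod_meas1 _ _ _ _ _ m1 m2 (EFin \o f)); last first.
  exact: (bounded_measurable_integrable (prod_prob m1 m2) bf).
apply: eq_integral => x _; rewrite EFin_mean//.
exact: (bounded_measurable_comp _ bf).
Qed.

End product.

Lemma mean_swap d1 d2 (T1 : measurableType d1) (T2 : measurableType d2)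
    (m1 : probability T1 R) (m2 : probability T2 R) (f : T1 * T2 -> R) :
  bounded_measurable f ->
  \int[m1]_x \int[m2]_y f (x, y) = \int[m2]_y \int[m1]_x f (x, y).
Proof.
move=> bf.
have bfs : bounded_measurable (fun z => f (z.2, z.1)).
  by apply: (bounded_measurable_comp _ bf); exact: measurable_swap.
have b1 x : bounded_measurable (fun y => f (x, y)).
  exact: (bounded_measurable_comp _ bf).
have b2 y : bounded_measurable (fun x => f (x, y)).
  exact: (bounded_measurable_comp _ bf).
apply: EFin_inj; rewrite EFin_mean; last exact: bounded_measurable_mean2.
under eq_integral do rewrite EFin_mean//.
rewrite (@Fubini _ _ _ _ _ m1 m2 (EFin \o f)); last first.
  exact: (bounded_measurable_integrable (prod_prob m1 m2) bf).
rewrite EFin_mean; last exact: (bounded_measurable_mean2 m2 m1 bfs).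
by apply: eq_integral => y _; rewrite EFin_mean.
Qed.

Lemma mean_distribution dO dT (Om : measurableType dO) (T : measurableType dT)
    (m : probability Om R) (X : {RV m >-> T}) (f : T -> R) :
  bounded_measurable f -> \int[distribution m X]_y f y = \int[m]_w f (X w).
Proof.
move=> bf; congr fine.
rewrite integral_distribution//; first by apply/measurable_EFinP; case: bf.
apply: (bounded_measurable_integrable m (f := f \o X)).
exact: (bounded_measurable_comp _ bf).
Qed.

End bounded_measurable.

(** * Independent pairs, conditional expectation and the moment ratio *)

Section pair_RV.
Context dO (Om : measurableType dO).
Context d1 d2 (T1 : measurableType d1) (T2 : measurableType d2).
Variables (X : {mfun Om >-> T1}) (Y : {mfun Om >-> T2}).

Definition pair_RV (w : Om) : T1 * T2 := (X w, Y w).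

Lemma measurable_pair_RV : measurable_fun [set: Om] pair_RV.
Proof. by apply: measurable_fun_pair; exact: measurable_funP. Qed.

HB.instance Definition _ :=
  isMeasurableFun.Build _ _ _ _ pair_RV measurable_pair_RV.

Context {R : realType} (Pr : probability Om R).
Variables (m1 : probability T1 R) (m2 : probability T2 R).

(** Rectangles form a pi-system that generates the product sigma-algebra. The
    auxiliary event W makes it possible to treat several variables one after the
    other: those already treated, or still to be treated, enter through W. *)
Lemma pair_law_restr (W : set Om) : measurable W ->
  (forall A B, measurable A -> measurable B ->
    Pr (X @^-1` A `&` Y @^-1` B `&` W) = (m1 A * m2 B * Pr W)%E) ->
  forall E, measurable E ->
    Pr (pair_RV @^-1` E `&` W) = (prod_prob m1 m2 E * Pr W)%E.
Proof.
move=> mW H E mE.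
pose c : {nonneg R} := NngNum (fine_ge0 (measure_ge0 Pr W)).
have cE : (c%:num)%:E = Pr W by rewrite fineK// fin_num_measure.
pose C : set (set (T1 * T2)) :=
  [set C | exists A, measurable A /\ exists B, measurable B /\ C = A `*` B].
have CI : setI_closed C.
  move=> /= _ _ [U1 [mU1 [U2 [mU2 ->]]]] [V1 [mV1 [V2 [mV2 ->]]]].
  rewrite -setXI; exists (U1 `&` V1); split; first exact: measurableI.
  by exists (U2 `&` V2); split => //; exact: measurableI.
have key : pushforward (mrestr Pr mW) pair_RV E =
           mscale c (prod_prob m1 m2) E.
  apply: (measure_unique C (fun=> setT)) => //.
  - rewrite measurable_prod_measurableType //; congr (<<s _ >>).
    rewrite predeqE; split => [[A mA [B mB <-]]|[A [mA [B [mB ->]]]]].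
      by exists A; split => //; exists B.
    by exists A => //; exists B.
  - by move=> _; exists setT; split => //; exists setT; rewrite setXTT.
  - by rewrite bigcup_const//; exists 0.
  - move=> _ [A [mA [B [mB ->]]]].
    rewrite /pushforward /mrestr /mscale /= [X in X = _]H//.
    transitivity (c%:num%:E * prod_prob m1 m2 (A `*` B))%E => //.
    by rewrite cE muleC /prod_prob product_measure1E.
  - move=> _; rewrite /pushforward /mrestr /=.
    apply: (@le_lt_trans _ _ 1%E); last by rewrite ltry.
    apply: probability_le1; apply: measurableI => //.
    by rewrite preimage_setT.
move: key; rewrite /pushforward /mrestr /= => ->.
transitivity (c%:num%:E * prod_prob m1 m2 E)%E => //.
by rewrite cE muleC.
Qed.

End pair_RV.

Section independent_pairs.
Context {R : realType} dO (Om : measurableType dO) (Pr : probability Om R).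
Context dE (E : measurableType dE) (P Q : probability E R).
Variables X1 X2 Y1 Y2 : {RV Pr >-> E}.
Hypothesis indep : mutually_independent (tnth [tuple X1; X2; Y1; Y2]).
Hypotheses (lX1 : has_law X1 Q) (lX2 : has_law X2 Q).
Hypotheses (lY1 : has_law Y1 P) (lY2 : has_law Y2 P).

Lemma independent_events A B C D :
  measurable A -> measurable B -> measurable C -> measurable D ->
  Pr (X1 @^-1` A `&` Y1 @^-1` B `&` (X2 @^-1` C `&` Y2 @^-1` D)) =
  (Q A * P B * (Q C * P D))%E.
Proof.
move=> mA mB mC mD.
have := indep [set: 'I_4]%SET (A := tnth [tuple A; C; B; D]).
rewrite (_ : \bigcap_(i in _) _ =
   X1 @^-1` A `&` Y1 @^-1` B `&` (X2 @^-1` C `&` Y2 @^-1` D)).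
  move=> ->; last by move=> [[|[|[|[|//]]]] ?] //=.
  rewrite (eq_bigl xpredT); last by move=> i; rewrite inE.
  rewrite !big_ord_recl big_ord0 /= mule1.
  have -> : Pr (X1 @^-1` A) = Q A by exact: lX1.
  have -> : Pr (X2 @^-1` C) = Q C by exact: lX2.
  have -> : Pr (Y1 @^-1` B) = P B by exact: lY1.
  have -> : Pr (Y2 @^-1` D) = P D by exact: lY2.
  by rewrite -muleA (muleCA (P B)).
apply/seteqP; split => [w H|w [[? ?] [? ?]]] /=.
  have K (i : 'I_4) := H i (finset.in_setT i).
  split; split.
  - exact: (K (Ordinal (isT : (0 < 4)%N))).
  - exact: (K (Ordinal (isT : (2 < 4)%N))).
  - exact: (K (Ordinal (isT : (1 < 4)%N))).
  - exact: (K (Ordinal (isT : (3 < 4)%N))).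
by move=> [[|[|[|[|//]]]] ?] //=.
Qed.

(** Mutual independence speaks about boxes with four sides only. It is extended
    to arbitrary events one pair at a time, while the other pair stays in the
    fixed event of [pair_law_restr]. *)
Lemma independent_pairs_law (F : set ((E * E) * (E * E))) : measurable F ->
  distribution Pr (pair_RV (pair_RV X1 Y1) (pair_RV X2 Y2)) F =
  prod_prob (prod_prob Q P) (prod_prob Q P) F.
Proof.
move=> mF.
have mpre dT (T : measurableType dT) (X : {RV Pr >-> T}) A :
    measurable A -> measurable (X @^-1` A).
  by move=> mA; exact: measurable_funPTI.
pose Z1 : {RV Pr >-> (E * E)%type} := pair_RV X1 Y1.
pose Z2 : {RV Pr >-> (E * E)%type} := pair_RV X2 Y2.
pose nu := prod_prob Q P.
have PT : Pr setT = 1%E by exact: probability_setT.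
have law2 C D : measurable C -> measurable D ->
    Pr (X2 @^-1` C `&` Y2 @^-1` D) = (Q C * P D)%E.
  move=> mC mD; have := independent_events measurableT measurableT mC mD.
  rewrite !preimage_setT !setTI (probability_setT Q) (probability_setT P).
  by rewrite !mul1e.
have law1r A C D : measurable A -> measurable C -> measurable D ->
    Pr (Z1 @^-1` A `&` (X2 @^-1` C `&` Y2 @^-1` D)) = (nu A * (Q C * P D))%E.
  move=> mA mC mD; rewrite -law2//; apply: pair_law_restr => //.
    by apply: measurableI; exact: mpre.
  by move=> A1 A2 mA1 mA2; rewrite law2// independent_events.
have law1 A : measurable A -> Pr (Z1 @^-1` A) = nu A.
  move=> mA; have := law1r A setT setT mA measurableT measurableT.
  rewrite !preimage_setT !setIT (probability_setT Q) (probability_setT P).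
  by rewrite !mule1.
have law12 A B : measurable A -> measurable B ->
    Pr (Z1 @^-1` A `&` Z2 @^-1` B) = (nu A * nu B)%E.
  move=> mA mB; rewrite setIC muleC -(law1 A)//.
  apply: pair_law_restr => //; first exact: mpre.
  by move=> C D mC mD; rewrite setIC law1r// law1// muleC.
have := @pair_law_restr _ _ _ _ _ _ Z1 Z2 _ Pr nu nu setT measurableT.
rewrite PT => /(_ _ F mF); rewrite setIT mule1; apply.
by move=> A B mA mB; rewrite setIT mule1 law12.
Qed.

End independent_pairs.

Section conditional_expectation.
Context {R : realType} dO (Om : measurableType dO) (Pr : probability Om R).
Context dE (E : measurableType dE).
Implicit Types h k : Om -> R.

(** The event that h exceeds k belongs to the sigma-algebra of Z, so h and k have
    the same integral over it; as h - k is positive there, it is negligible. *)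
Lemma cond_expectation_le_ae (X : Om -> R) (Z : Om -> E) h k :
  measurable_fun [set: Om] Z ->
  is_cond_expectation Pr X Z h -> is_cond_expectation Pr X Z k ->
  {ae Pr, forall w, h w <= k w}.
Proof.
move=> mZ [mh ih hX] [mk ik kX].
pose A := [set w | k w < h w].
have gA : g_sigma_algebra_preimage Z A.
  have := measurable_fun_ltr mk mh measurableT (Y := [set true]).
  by rewrite setTI; apply.
have mA : measurable A.
  by case: gA => B mB <-; exact: mZ.
have iA f : Pr.-integrable setT (EFin \o f) -> Pr.-integrable A (EFin \o f).
  by apply: integrableS.
have mhk : measurable_fun A (fun w => (h w - k w)%:E).
  have := integrableB measurableT ih ik.
  move=> /measurable_int; apply: measurable_funS => //.
have : (\int[Pr]_(w in A) `|(h w - k w)%:E| = 0)%E.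
  transitivity (\int[Pr]_(w in A) ((h w)%:E - (k w)%:E))%E.
    apply: eq_integral => w /set_mem; rewrite /A /= => kh.
    by rewrite /= ger0_norm ?EFinB// subr_ge0 ltW.
  rewrite integralB//; [|exact: iA|exact: iA].
  rewrite [X in (X - _)%E]hX// [X in (_ - X)%E]kX//.
  rewrite -hX// subee//.
  by apply: integrable_fin_num => //; exact: iA.
move/(ae_eq_integral_abs Pr mA mhk); apply: filterS => w hk.
rewrite leNgt; apply/negP => kh; have := hk kh.
by move=> /= [] /eqP; rewrite subr_eq0 => /eqP E0; rewrite E0 ltxx in kh.
Qed.

Lemma variance_cond_expectation (X : Om -> R) (Z : Om -> E) h :
  measurable_fun [set: Om] Z -> is_cond_expectation Pr X Z h ->
  'V_Pr[cond_expectation Pr X Z] = 'V_Pr[h].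
Proof.
move=> mZ hX.
have cX : is_cond_expectation Pr X Z (cond_expectation Pr X Z).
  exact: (@xgetPex _ (cst 0) [set h | is_cond_expectation Pr X Z h] (ex_intro _ h hX)).
move: (cond_expectation Pr X Z) cX => c cX.
have ch : {ae Pr, forall w, c w = h w}.
  have := cond_expectation_le_ae mZ cX hX; have := cond_expectation_le_ae mZ hX cX.
  by apply: filterS2 => w hc chw; apply/eqP; rewrite eq_le hc chw.
have mc : measurable_fun setT c.
  by case: cX => _ /measurable_int /measurable_EFinP.
have mh : measurable_fun setT h.
  by case: hX => _ /measurable_int /measurable_EFinP.
have Ech : ('E_Pr[c] = 'E_Pr[h])%E.
  rewrite unlock; apply: ae_eq_integral => //; [exact/measurable_EFinP..|].
  by apply: filterS ch => w -> _.
rewrite /variance covariance.unlock Ech unlock.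
apply: ae_eq_integral => //.
- by apply/measurable_EFinP; apply: measurable_funM; exact: measurable_funB.
- by apply/measurable_EFinP; apply: measurable_funM; exact: measurable_funB.
- by apply: filterS ch => w /= e _; rewrite /= !fctE /= e.
Qed.

Variables (nu1 nu2 : probability E R) (Z1 Z2 : {RV Pr >-> E}).
Hypothesis law12 : forall F, measurable F ->
  distribution Pr (pair_RV Z1 Z2) F = prod_prob nu1 nu2 F.
Variable u : E * E -> R.
Hypothesis bu : bounded_measurable u.

Lemma mean_joint (f : E * E -> R) : bounded_measurable f ->
  \int[Pr]_w f (Z1 w, Z2 w) = \int[prod_prob nu1 nu2]_z f z.
Proof.
move=> bf; rewrite -(mean_distribution (pair_RV Z1 Z2) bf).
by congr fine; apply: eq_measure_integral => A mA _; exact: law12.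
Qed.

Lemma mean_first (f : E -> R) : bounded_measurable f ->
  \int[Pr]_w f (Z1 w) = \int[nu1]_z f z.
Proof.
move=> bf.
have bf1 : bounded_measurable (fun z : E * E => f z.1).
  by apply: (bounded_measurable_comp _ bf); exact: measurable_fst.
rewrite (mean_joint bf1) mean_prod//; apply: eq_mean => z /=.
by rewrite mean_cst.
Qed.

(** On the event that Z1 lies in B, the product law turns the integral of
    u (Z1, Z2) into an iterated one, whose inner integral is the stated version. *)
Lemma is_cond_expectation_mean :
  is_cond_expectation Pr (fun w => u (Z1 w, Z2 w)) Z1
    (fun w => \int[nu2]_z u (Z1 w, z)).
Proof.
have bg := bounded_measurable_mean2 nu1 nu2 bu.
have bgZ : bounded_measurable (fun w => \int[nu2]_z u (Z1 w, z)).
  by apply: (bounded_measurable_comp _ bg); exact: measurable_funP.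
have buZ : bounded_measurable (fun w => u (Z1 w, Z2 w)).
  apply: (bounded_measurable_comp _ bu).
  exact: measurable_pair_RV.
split.
- case: bg => mg _ _ B mB.
  exists ((fun z => \int[nu2]_y u (z, y)) @^-1` B) => //.
  by rewrite -[X in measurable X]setTI; exact: mg.
- exact: bounded_measurable_integrable.
- move=> _ [B mB <-]; rewrite !setTI.
  have bB : bounded_measurable (\1_B : E -> R).
    split; first exact: measurable_indic.
    by exists 1 => x; rewrite indicE; case: (_ \in _); rewrite ?normr1 ?normr0.
  have bB1 : bounded_measurable (fun z : E * E => \1_B z.1 : R).
    by apply: (bounded_measurable_comp _ bB); exact: measurable_fst.
  have restr (f : Om -> R) : bounded_measurable f ->
      (\int[Pr]_(w in Z1 @^-1` B) (f w)%:E)%E =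
      (\int[Pr]_w (\1_B (Z1 w) * f w))%:E.
    move=> bf; rewrite EFin_mean; last first.
      apply: bounded_measurableM bf; apply: (bounded_measurable_comp _ bB).
      exact: measurable_funP.
    rewrite integral_mkcond; apply: eq_integral => w _.
    by rewrite restrict_EFin patch_indic /= mulrC.
  rewrite !restr//; congr EFin.
  rewrite (mean_first (f := fun z => \1_B z * \int[nu2]_y u (z, y))); last first.
    exact: bounded_measurableM.
  rewrite (mean_joint (f := fun z => \1_B z.1 * u z)); last first.
    exact: bounded_measurableM.
  rewrite mean_prod; last exact: bounded_measurableM.
  apply: eq_mean => z /=; rewrite meanZl//.
  exact: (bounded_measurable_comp _ bu).
Qed.

Lemma moment_ratioE :
  moment_ratio Pr (fun z z' => u (z, z')) Z1 Z2 =
  Num.sqrt (\int[prod_prob nu1 nu2]_z u z ^+ 2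
            - (\int[prod_prob nu1 nu2]_z u z) ^+ 2) /
  Num.sqrt (\int[nu1]_z (\int[nu2]_y u (z, y)) ^+ 2
            - (\int[prod_prob nu1 nu2]_z u z) ^+ 2).
Proof.
have bg := bounded_measurable_mean2 nu1 nu2 bu.
rewrite /moment_ratio /sigma_full /sigma_cond.
rewrite (variance_cond_expectation _ is_cond_expectation_mean)//.
rewrite !variance_mean; last 2 first.
- by apply: (bounded_measurable_comp _ bg); exact: measurable_funP.
- by apply: (bounded_measurable_comp _ bu); exact: measurable_pair_RV.
rewrite (mean_joint bu) (mean_first bg).
rewrite (mean_joint (f := fun z => u z ^+ 2)); last first.
  by under eq_fun do rewrite expr2; exact: bounded_measurableM.
rewrite (mean_first (f := fun z => (\int[nu2]_y u (z, y)) ^+ 2)); last first.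
  by under eq_fun do rewrite expr2; exact: bounded_measurableM.
by rewrite -(mean_prod nu1 nu2 bu).
Qed.

End conditional_expectation.

(** * Gaussian means of Gaussian kernels *)

Section gaussian_means.
Context {R : realType}.
Implicit Types (s a m : R).

(** The Radon-Nikodym derivative is almost everywhere unique, so it can be
    replaced by the density that defines the law. *)
Lemma integral_normal_prob m s (f : R -> \bar R) :
  (normal_prob m s).-integrable [set: measurableTypeR R] f ->
  (\int[normal_prob m s]_x f x =
   \int[lebesgue_measure]_x (f x * (normal_pdf m s x)%:E))%E.
Proof.
move=> intf; have mf := measurable_int _ intf.
have dom := normal_prob_dominates m s.
have mpdf : measurable_fun [set: measurableTypeR R] (fun x => (normal_pdf m s x)%:E).
  by apply/measurable_EFinP; exact: measurable_normal_pdf.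
rewrite -(Radon_Nikodym_change_of_variables dom)//=.
apply: ae_eq_integral => //.
- exact: emeasurable_funM.
- exact: emeasurable_funM.
- suff : ae_eq lebesgue_measure [set: measurableTypeR R]
      (Radon_Nikodym (charge_of_finite_measure (normal_prob m s)) lebesgue_measure)
      (fun x => (normal_pdf m s x)%:E).
    by apply: filterS => x /= H _; rewrite H.
  rewrite Radon_NikodymE//=; case: cid => /= h [h1 h2 h3].
  apply: integral_ae_eq => //=.
  by move=> E E01 mE; rewrite -h3.
Qed.

(** Completion of the square: the product is proportional to the normal density
    whose precision is 1 + 1 / s and whose mean is the precision-weighted average
    of a and m. *)
Lemma gauss_mul_normal_pdf s a m (x : R) : 0 < s ->
  expR (- ((a - x) ^+ 2 / (2 * s))) * normal_pdf m 1 x =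
  Num.sqrt (s / (s + 1)) * expR (- ((a - m) ^+ 2 / (2 * (s + 1)))) *
  normal_pdf ((a + s * m) / (s + 1)) (Num.sqrt (s / (s + 1))) x.
Proof.
move=> s0; have s10 : 0 < s + 1 by rewrite addr_gt0.
have t0 : 0 < s / (s + 1) by rewrite divr_gt0.
have r0 : 0 < Num.sqrt (s / (s + 1)) by rewrite sqrtr_gt0.
rewrite !normal_pdfE ?oner_eq0 ?gt_eqF//.
have -> : normal_peak 1 = Num.sqrt (s / (s + 1)) * normal_peak (Num.sqrt (s / (s + 1))).
  rewrite /normal_peak expr1n mul1r sqr_sqrtr ?ltW//.
  move: t0 r0; set t := s / (s + 1) => t0 r0.
  rewrite -mulrnAr (sqrtrM (pi *+ 2) (ltW t0)).
  by rewrite invfM mulrA divff ?gt_eqF// mul1r.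
rewrite /normal_fun sqr_sqrtr ?ltW//.
set p := normal_peak _; set r := Num.sqrt _.
transitivity (r * p * (expR (- ((a - x) ^+ 2 / (2 * s))) *
    expR (- (x - m) ^+ 2 / (1 ^+ 2 *+ 2)))); first by ring.
transitivity (r * p * (expR (- ((a - m) ^+ 2 / (2 * (s + 1)))) *
    expR (- (x - (a + s * m) / (s + 1)) ^+ 2 / (s / (s + 1) *+ 2)))); last by ring.
rewrite -!expRD; congr (_ * expR _).
by field; rewrite !gt_eqF.
Qed.

Lemma measurable_idR : measurable_fun [set: measurableTypeR R] (idfun : _ -> R).
Proof. by move=> _ A mA; rewrite setTI. Qed.

Lemma bounded_measurable_gauss s a : 0 < s ->
  bounded_measurable (fun x : R => expR (- ((a - x) ^+ 2 / (2 * s)))).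
Proof.
move=> s0; split.
  apply: measurableT_comp => //; apply: measurableT_comp => //.
  apply: measurable_funM => //; apply: measurable_funX.
  exact: measurable_funB.
exists 1 => x; rewrite ger0_norm ?expR_ge0// -expR0 ler_expR oppr_le0.
by rewrite divr_ge0 ?sqr_ge0// mulr_ge0// ltW.
Qed.

Lemma mean_normal_gauss s a m : 0 < s ->
  \int[normal_prob m 1]_x expR (- ((a - x) ^+ 2 / (2 * s))) =
  Num.sqrt (s / (s + 1)) * expR (- ((a - m) ^+ 2 / (2 * (s + 1)))).
Proof.
move=> s0; apply: EFin_inj.
have bg : bounded_measurable
    ((fun x => expR (- ((a - x) ^+ 2 / (2 * s)))) : measurableTypeR R -> R).
  exact: (bounded_measurable_comp measurable_idR (bounded_measurable_gauss a s0)).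
rewrite EFin_mean//.
rewrite integral_normal_prob; last first.
  exact: (bounded_measurable_integrable (normal_prob m 1) bg).
under eq_integral do rewrite -EFinM gauss_mul_normal_pdf// EFinM.
rewrite integralZl//=; last exact: integrable_normal_pdf.
by rewrite integral_normal_pdf mule1.
Qed.

Lemma bounded_measurable_prod dT (T : measurableType dT) n (f : 'I_n -> T -> R) :
  (forall i, bounded_measurable (f i)) ->
  bounded_measurable (fun t => \prod_(i < n) f i t).
Proof.
elim: n f => [|n IHn] f bf.
  by under eq_fun do rewrite big_ord0; exact: bounded_measurable_cst.
under eq_fun do rewrite big_ord_recl; apply: bounded_measurableM => //.
by apply: IHn => i.
Qed.

Lemma mean_tuple_prob n (nu : 'I_n -> probability (measurableTypeR R) R)
    (f : 'I_n -> R -> R) : (forall i, bounded_measurable (f i)) ->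
  \int[tuple_prob nu]_x \prod_(i < n) f i (tnth x i) =
  \prod_(i < n) \int[nu i]_x f i x.
Proof.
elim: n nu f => [|n IHn] nu f bf.
  by rewrite big_ord0; under eq_Rintegral do rewrite big_ord0; rewrite mean_cst.
have bfR i : bounded_measurable (f i : measurableTypeR R -> R).
  exact: (bounded_measurable_comp measurable_idR (bf i)).
have bt k (g : 'I_k -> R -> R) : (forall i, bounded_measurable (g i)) ->
    bounded_measurable (fun x : k.-tuple R => \prod_(i < k) g i (tnth x i)).
  move=> bg; apply: bounded_measurable_prod => i.
  by apply: (bounded_measurable_comp _ (bg i)); exact: measurable_tnth.
have bl := bt n _ (fun i => bf (lift ord0 i)).
rewrite /= mean_distribution; last exact: bt.
transitivity (\int[prod_prob (nu ord0) (tuple_prob (fun i => nu (lift ord0 i)))]_z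
    (f ord0 z.1 * \prod_(i < n) f (lift ord0 i) (tnth z.2 i))).
  apply: eq_mean => z; rewrite big_ord_recl; congr (_ * _).
  by apply: eq_bigr => i _; rewrite tnthS.
rewrite mean_prod; last first.
  apply: bounded_measurableM.
    by apply: (bounded_measurable_comp _ (bfR ord0)); exact: measurable_fst.
  by apply: (bounded_measurable_comp _ bl); exact: measurable_snd.
rewrite big_ord_recl -meanZr//.
apply: eq_mean => x /=; rewrite meanZl//; congr (_ * _).
exact: (IHn (fun i => nu (lift ord0 i)) (fun i => f (lift ord0 i))).
Qed.

Section tuples.
Context {d : nat}.
Implicit Types (x y z mu : d.-tuple R).

Lemma norm2_subt_sqr x y :
  norm2 (subt x y) ^+ 2 = \sum_(i < d) (tnth x i - tnth y i) ^+ 2.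
Proof.
rewrite /norm2 sqr_sqrtr; last by apply: sumr_ge0 => i _; exact: sqr_ge0.
by apply: eq_bigr => i _; rewrite tnth_mktuple.
Qed.

Lemma rbfE s x y :
  rbf s x y = \prod_(i < d) expR (- ((tnth x i - tnth y i) ^+ 2 / (2 * s))).
Proof. by rewrite /rbf norm2_subt_sqr mulr_suml -sumrN expR_sum. Qed.

Lemma rbfC s x y : rbf s x y = rbf s y x.
Proof.
by rewrite !rbfE; apply: eq_bigr => i _; rewrite -sqrrN opprB.
Qed.

Lemma rbfxx s x : rbf s x x = 1.
Proof.
by rewrite rbfE big1// => i _; rewrite subrr expr0n mul0r oppr0 expR0.
Qed.

Definition midt x y : d.-tuple R := [tuple (tnth x i + tnth y i) / 2 | i < d].

(** The parallelogram identity
    |x - z|^2 + |y - z|^2 = |x - y|^2 / 2 + 2 |z - (x + y) / 2|^2. *)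
Lemma rbf_mul s x y z : 0 < s ->
  rbf s x z * rbf s y z = rbf (2 * s) x y * rbf (s / 2) (midt x y) z.
Proof.
move=> s0; rewrite !rbfE -!big_split; apply: eq_bigr => i _ /=.
by rewrite tnth_mktuple -!expRD; congr expR; field; rewrite gt_eqF.
Qed.

Lemma rbf_sqr s x y : 0 < s -> rbf s x y ^+ 2 = rbf (s / 2) x y.
Proof.
move=> s0; rewrite !rbfE -prodrXl; apply: eq_bigr => i _.
by rewrite -expRM_natr; congr expR; field; rewrite gt_eqF.
Qed.

(** Convolution with a standard normal law adds 1 to the bandwidth; the kernel
    keeps its mass but gets wider, so each coordinate of its height shrinks. *)
Lemma mean_gaussian_rbf s x mu : 0 < s ->
  \int[gaussian mu]_y rbf s x y = Num.sqrt (s / (s + 1)) ^+ d * rbf (s + 1) x mu.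
Proof.
move=> s0.
under eq_Rintegral do rewrite rbfE.
rewrite (mean_tuple_prob _
  (f := fun i t => expR (- ((tnth x i - t) ^+ 2 / (2 * s))))); last first.
  by move=> i; exact: bounded_measurable_gauss.
under eq_bigr do rewrite mean_normal_gauss//.
by rewrite big_split /= prodr_const card_ord -rbfE.
Qed.

Lemma bounded_measurable_rbf s dT (T : measurableType dT) (f g : T -> d.-tuple R) :
  0 < s -> measurable_fun [set: T] f -> measurable_fun [set: T] g ->
  bounded_measurable (fun t => rbf s (f t) (g t)).
Proof.
move=> s0 mf mg; under eq_fun do rewrite rbfE.
apply: bounded_measurable_prod => i.
have mt (h : T -> d.-tuple R) : measurable_fun setT h ->
    measurable_fun setT (fun t => tnth (h t) i).
  by move=> mh; exact: (measurableT_comp (measurable_tnth i) mh).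
have := bounded_measurable_gauss 0 s0.
move/(@bounded_measurable_comp _ _ _ _ _ (fun t => tnth (g t) i - tnth (f t) i)).
have mB : measurable_fun setT (fun t => tnth (g t) i - tnth (f t) i).
  by apply: measurable_funB; exact: mt.
move=> /(_ mB); congr bounded_measurable; apply/funext => t.
by rewrite sub0r opprB.
Qed.

End tuples.
End gaussian_means.

(** * Moments of the MMD kernel *)

Section mmd_moments.
Context {R : realType}.

Section product_means.
Context d1 d2 (T1 : measurableType d1) (T2 : measurableType d2).
Variables (m1 : probability T1 R) (m2 : probability T2 R).

Lemma mean_prodM (f : T1 -> R) (g : T2 -> R) :
  bounded_measurable f -> bounded_measurable g ->
  \int[prod_prob m1 m2]_z (f z.1 * g z.2) = (\int[m1]_x f x) * \int[m2]_y g y.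
Proof.
move=> bf bg; rewrite mean_prod.
  by rewrite -meanZr//; apply: eq_mean => x /=; rewrite meanZl.
apply: bounded_measurableM.
  by apply: (bounded_measurable_comp _ bf); exact: measurable_fst.
by apply: (bounded_measurable_comp _ bg); exact: measurable_snd.
Qed.

Lemma mean_prod1 (f : T1 -> R) : bounded_measurable f ->
  \int[prod_prob m1 m2]_z f z.1 = \int[m1]_x f x.
Proof.
move=> bf; have := mean_prodM bf (bounded_measurable_cst T2 1).
by rewrite mean_cst mulr1 => <-; apply: eq_mean => z; rewrite mulr1.
Qed.

Lemma mean_prod2 (g : T2 -> R) : bounded_measurable g ->
  \int[prod_prob m1 m2]_z g z.2 = \int[m2]_y g y.
Proof.
move=> bg; have := mean_prodM (bounded_measurable_cst T1 1) bg.
by rewrite mean_cst mul1r => <-; apply: eq_mean => z; rewrite mul1r.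
Qed.

End product_means.

(** Exchanging the two pairs moves the variable shared by two kernels from the
    first pair to the second, which halves the number of mixed moments to be
    computed. *)
Lemma mean_exchange dT (T : measurableType dT) (m : probability T R)
    (f : T * T -> R) : bounded_measurable f ->
  \int[prod_prob m m]_z f (z.2, z.1) = \int[prod_prob m m]_z f z.
Proof.
move=> bf; rewrite (mean_prod m m bf) mean_swap// mean_prod//.
by apply: (bounded_measurable_comp _ bf); exact: measurable_swap.
Qed.

Section kernel_moments.
Context dT (T : measurableType dT) (K : R -> T -> T -> R) (shrink : R -> R).
Variables (a b : T) (Q P : probability T R) (g : R).
Hypothesis g0 : 0 < g.
Hypothesis bK : forall s, 0 < s -> bounded_measurable (fun z : T * T => K s z.1 z.2).
Hypothesis KC : forall s x y, K s x y = K s y x.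
Hypothesis Kxx : forall s x, K s x x = 1.
Hypothesis Ksqr : forall s x y, 0 < s -> K s x y ^+ 2 = K (s / 2) x y.

(** The only facts about the two Gaussian laws that the moments depend on: how
    the law m, centred at c, averages one kernel of the family K, and how it
    averages a product of kernels centred at a and b. *)
Definition smoothed_by (m : probability T R) (c : T) : Prop :=
  (forall s x, 0 < s -> \int[m]_y K s x y = shrink s * K (s + 1) x c) /\
  (forall s, 0 < s -> \int[m]_x (K s x a * K s x b) =
    shrink (s / 2) * (K (2 * s) a b * K (2 * (s + 2)) a b)).

Hypothesis smQ : smoothed_by Q a.
Hypothesis smP : smoothed_by P b.

Let nu := prod_prob Q P.

Let bK2 s dS (S : measurableType dS) (h k : S -> T) : 0 < s ->
  measurable_fun setT h -> measurable_fun setT k ->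
  bounded_measurable (fun t => K s (h t) (k t)).
Proof.
move=> s0 mh mk.
exact: (bounded_measurable_comp (measurable_fun_pair mh mk) (bK s0)).
Qed.

Let bKl s x : 0 < s -> bounded_measurable (K s x).
Proof. by move=> s0; exact: (bK2 (h := fun=> x) (k := fun y => y) s0). Qed.

Let bKr s x : 0 < s -> bounded_measurable (fun y => K s y x).
Proof. by move=> s0; exact: (bK2 (h := fun y => y) (k := fun=> x) s0). Qed.

Let smooth_l m c s x : smoothed_by m c -> 0 < s ->
  \int[m]_y K s x y = shrink s * K (s + 1) x c.
Proof. by case=> + _; apply. Qed.

Let smooth_r m c s x : smoothed_by m c -> 0 < s ->
  \int[m]_y K s y x = shrink s * K (s + 1) x c.
Proof.
move=> mc s0; rewrite -(smooth_l x mc s0); apply: eq_mean => y; exact: KC.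
Qed.

Let overlap (s : R) : R := K s a b.

Let mean_KM m c s : smoothed_by m c -> 0 < s ->
  \int[m]_x (K s x a * K s x b) =
  shrink (s / 2) * (overlap (2 * s) * overlap (2 * (s + 2))).
Proof. by case=> _; apply. Qed.

Let mean_Ksqr m c s c' : smoothed_by m c -> 0 < s ->
  \int[m]_x K s x c' ^+ 2 = shrink (s / 2) * K (s / 2 + 1) c' c.
Proof.
move=> mc s0; have s20 : 0 < s / 2 by rewrite divr_gt0.
rewrite -(smooth_r c' mc s20); apply: eq_mean => x; exact: Ksqr.
Qed.

Definition mmd (z : (T * T) * (T * T)) : R :=
  K g z.1.1 z.2.1 + K g z.1.2 z.2.2 - K g z.1.1 z.2.2 - K g z.2.1 z.1.2.

Let m11 : measurable_fun setT (fun z : (T * T) * (T * T) => z.1.1).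
Proof. exact: (measurableT_comp measurable_fst measurable_fst). Qed.
Let m12 : measurable_fun setT (fun z : (T * T) * (T * T) => z.1.2).
Proof. exact: (measurableT_comp measurable_snd measurable_fst). Qed.
Let m21 : measurable_fun setT (fun z : (T * T) * (T * T) => z.2.1).
Proof. exact: (measurableT_comp measurable_fst measurable_snd). Qed.
Let m22 : measurable_fun setT (fun z : (T * T) * (T * T) => z.2.2).
Proof. exact: (measurableT_comp measurable_snd measurable_snd). Qed.

Let k1 (z : (T * T) * (T * T)) := K g z.1.1 z.2.1.
Let k2 (z : (T * T) * (T * T)) := K g z.1.2 z.2.2.
Let k3 (z : (T * T) * (T * T)) := K g z.1.1 z.2.2.
Let k4 (z : (T * T) * (T * T)) := K g z.2.1 z.1.2.

Let bk1 : bounded_measurable k1. Proof. exact: (bK2 g0 m11 m21). Qed.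
Let bk2 : bounded_measurable k2. Proof. exact: (bK2 g0 m12 m22). Qed.
Let bk3 : bounded_measurable k3. Proof. exact: (bK2 g0 m11 m22). Qed.
Let bk4 : bounded_measurable k4. Proof. exact: (bK2 g0 m21 m12). Qed.

Lemma bounded_measurable_mmd : bounded_measurable mmd.
Proof.
rewrite (_ : mmd = fun z => k1 z + k2 z - k3 z - k4 z); last by apply/funext.
by do 2 apply: bounded_measurableB => //; apply: bounded_measurableD.
Qed.

(** Up to the factor [shrink g], the witness function of the MMD: the difference
    of the mean embeddings of Q and P. *)
Let phi (x : T) := K (g + 1) x a - K (g + 1) x b.

Let g10 : 0 < g + 1. Proof. by rewrite addr_gt0. Qed.
Let g20 : 0 < g / 2. Proof. by rewrite divr_gt0. Qed.

Let bphi : bounded_measurable phi.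
Proof. by apply: bounded_measurableB; exact: bKr. Qed.

Let mean_mmd2 (z : T * T) :
  \int[nu]_z' mmd (z, z') = shrink g * (phi z.1 - phi z.2).
Proof.
have b1 := bK2 g0 (measurable_cst z.1) (@measurable_fst _ _ T T).
have b2 := bK2 g0 (measurable_cst z.2) (@measurable_snd _ _ T T).
have b3 := bK2 g0 (measurable_cst z.1) (@measurable_snd _ _ T T).
have b4 := bK2 g0 (@measurable_fst _ _ T T) (measurable_cst z.2).
have b12 := bounded_measurableD b1 b2.
have b123 := bounded_measurableB b12 b3.
rewrite /mmd /= (meanB _ b123 b4) (meanB _ b12 b3) (meanD _ b1 b2).
rewrite (mean_prod1 Q P (bKl z.1 g0)) (mean_prod2 Q P (bKl z.2 g0)).
rewrite (mean_prod2 Q P (bKl z.1 g0)) (mean_prod1 Q P (bKr z.2 g0)).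
rewrite (smooth_r _ smQ g0) (smooth_l z.1 smQ g0) (smooth_l z.1 smP g0).
by rewrite (smooth_l z.2 smP g0) /phi; ring.
Qed.

Let mean_phi_a : \int[Q]_x phi x = shrink (g + 1) * (1 - overlap (g + 2)).
Proof.
rewrite /phi meanB; [|exact: bKr|exact: bKr].
rewrite !(smooth_r _ smQ g10) Kxx (KC _ b a) /overlap.
by rewrite (_ : g + 1 + 1 = g + 2); ring.
Qed.

Let mean_phi_b : \int[P]_x phi x = - (shrink (g + 1) * (1 - overlap (g + 2))).
Proof.
rewrite /phi meanB; [|exact: bKr|exact: bKr].
rewrite !(smooth_r _ smP g10) Kxx /overlap.
by rewrite (_ : g + 1 + 1 = g + 2); ring.
Qed.

Let cross_overlap := overlap (2 * (g + 1)) * overlap (2 * (g + 3)).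

Let mean_phi_sqr (m : probability T R) (c : T) : smoothed_by m c ->
  (c = a) \/ (c = b) ->
  \int[m]_x phi x ^+ 2 =
  shrink ((g + 1) / 2) * (1 + overlap ((g + 3) / 2) - 2 * cross_overlap).
Proof.
move=> mc cab.
transitivity (\int[m]_x (K (g + 1) x a ^+ 2 + K (g + 1) x b ^+ 2 -
    2 * (K (g + 1) x a * K (g + 1) x b))).
  by apply: eq_mean => x; rewrite /phi; ring.
have ba := bKr a g10; have bb := bKr b g10.
have bab := bounded_measurableM ba bb.
have baa : bounded_measurable (fun x => K (g + 1) x a ^+ 2).
  exact: (bounded_measurableM ba ba).
have bbb : bounded_measurable (fun x => K (g + 1) x b ^+ 2).
  exact: (bounded_measurableM bb bb).
rewrite meanB; [|exact: bounded_measurableD|].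
  rewrite meanD// meanZl// (mean_KM mc g10) !(mean_Ksqr _ mc g10).
  have -> : (g + 1) / 2 + 1 = (g + 3) / 2 by field.
  have -> : g + 1 + 2 = g + 3 by ring.
  rewrite /cross_overlap.
  by case: cab => ->; rewrite Kxx ?(KC _ b a) -/(overlap _); ring.
by apply: bounded_measurableM => //; exact: bounded_measurable_cst.
Qed.

Let bphi1 : bounded_measurable (fun z : T * T => phi z.1).
Proof. by apply: (bounded_measurable_comp _ bphi); exact: measurable_fst. Qed.
Let bphi2 : bounded_measurable (fun z : T * T => phi z.2).
Proof. by apply: (bounded_measurable_comp _ bphi); exact: measurable_snd. Qed.

Lemma mean_mmd : \int[prod_prob nu nu]_z mmd z =
  2 * (shrink g * shrink (g + 1)) * (1 - overlap (g + 2)).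
Proof.
rewrite mean_prod; last exact: bounded_measurable_mmd.
under eq_Rintegral do rewrite mean_mmd2.
rewrite meanZl; last exact: bounded_measurableB.
rewrite meanB// (mean_prod1 Q P bphi) (mean_prod2 Q P bphi).
by rewrite mean_phi_a mean_phi_b; ring.
Qed.

Lemma variance_cond_mmd :
  \int[nu]_z (\int[nu]_z' mmd (z, z')) ^+ 2 - (\int[prod_prob nu nu]_z mmd z) ^+ 2
  = 2 * shrink g ^+ 2 *
    (shrink ((g + 1) / 2) * (1 + overlap ((g + 3) / 2) - 2 * cross_overlap) -
     (shrink (g + 1) * (1 - overlap (g + 2))) ^+ 2).
Proof.
rewrite mean_mmd.
transitivity (\int[nu]_z (shrink g ^+ 2 *
    (phi z.1 ^+ 2 + phi z.2 ^+ 2 - 2 * (phi z.1 * phi z.2))) -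
    (2 * (shrink g * shrink (g + 1)) * (1 - overlap (g + 2))) ^+ 2).
  by congr (_ - _); apply: eq_mean => z; rewrite mean_mmd2; ring.
have b2 := bounded_measurableM bphi bphi.
have b11 := bounded_measurableM bphi1 bphi1.
have b22 := bounded_measurableM bphi2 bphi2.
have b12 := bounded_measurableM bphi1 bphi2.
have b212 := bounded_measurableM (bounded_measurable_cst _ 2) b12.
have bD := bounded_measurableD b11 b22.
rewrite meanZl; last exact: bounded_measurableB.
rewrite meanB// meanD// meanZl//.
rewrite (mean_prodM Q P bphi bphi) (mean_prod1 Q P b2) (mean_prod2 Q P b2).
rewrite (mean_phi_sqr smQ (or_introl erefl)) (mean_phi_sqr smP (or_intror erefl)).
by rewrite mean_phi_a mean_phi_b; ring.
Qed.

Let diag := shrink (g / 2) * shrink (g / 2 + 1).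

Let bMM (f h : (T * T) * (T * T) -> R) : bounded_measurable f ->
  bounded_measurable h -> bounded_measurable (fun z => f z * h z).
Proof. exact: bounded_measurableM. Qed.

Let mean_k1k3 : \int[prod_prob nu nu]_z (k1 z * k3 z) =
  shrink g ^+ 2 * (shrink ((g + 1) / 2) * cross_overlap).
Proof.
rewrite mean_prod; last exact: bMM.
transitivity (\int[nu]_z (shrink g ^+ 2 *
    (K (g + 1) z.1 a * K (g + 1) z.1 b))).
  apply: eq_mean => z; rewrite /k1 /k3 /=.
  rewrite (mean_prodM Q P (bKl z.1 g0) (bKl z.1 g0)).
  by rewrite (smooth_l _ smQ g0) (smooth_l _ smP g0); ring.
have bab := bounded_measurableM (bKr a g10) (bKr b g10).
rewrite meanZl; last first.
  by apply: (bounded_measurable_comp _ bab); exact: measurable_fst.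
rewrite (mean_prod1 Q P bab) (mean_KM smQ g10).
by rewrite (_ : g + 1 + 2 = g + 3)//; ring.
Qed.

Let mean_k2k4 : \int[prod_prob nu nu]_z (k2 z * k4 z) =
  shrink g ^+ 2 * (shrink ((g + 1) / 2) * cross_overlap).
Proof.
rewrite mean_prod; last exact: bMM.
transitivity (\int[nu]_z (shrink g ^+ 2 *
    (K (g + 1) z.2 a * K (g + 1) z.2 b))).
  apply: eq_mean => z; rewrite /k2 /k4 /=.
  under eq_Rintegral do rewrite mulrC.
  rewrite (mean_prodM Q P (bKr z.2 g0) (bKl z.2 g0)).
  by rewrite (smooth_r _ smQ g0) (smooth_l _ smP g0); ring.
have bab := bounded_measurableM (bKr a g10) (bKr b g10).
rewrite meanZl; last first.
  by apply: (bounded_measurable_comp _ bab); exact: measurable_snd.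
rewrite (mean_prod2 Q P bab) (mean_KM smP g10).
by rewrite (_ : g + 1 + 2 = g + 3)//; ring.
Qed.

Let mean_k1k4 : \int[prod_prob nu nu]_z (k1 z * k4 z) =
  shrink g ^+ 2 * (shrink ((g + 1) / 2) * cross_overlap).
Proof.
rewrite -mean_k1k3 -[RHS](mean_exchange nu (bMM bk1 bk3)); apply: eq_mean => z.
by rewrite /k1 /k3 /k4 /= (KC g z.2.1 z.1.1).
Qed.

Let mean_k2k3 : \int[prod_prob nu nu]_z (k2 z * k3 z) =
  shrink g ^+ 2 * (shrink ((g + 1) / 2) * cross_overlap).
Proof.
rewrite -mean_k2k4 -[RHS](mean_exchange nu (bMM bk2 bk4)); apply: eq_mean => z.
by rewrite /k2 /k3 /k4 /= (KC g z.2.2 z.1.2).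
Qed.

Let mean_k1k2 : \int[prod_prob nu nu]_z (k1 z * k2 z) =
  (shrink g * shrink (g + 1)) ^+ 2.
Proof.
rewrite mean_prod; last exact: bMM.
transitivity (\int[nu]_z (shrink g ^+ 2 *
    (K (g + 1) z.1 a * K (g + 1) z.2 b))).
  apply: eq_mean => z; rewrite /k1 /k2 /=.
  rewrite (mean_prodM Q P (bKl z.1 g0) (bKl z.2 g0)).
  by rewrite (smooth_l _ smQ g0) (smooth_l _ smP g0); ring.
have ba := bKr a g10; have bb := bKr b g10.
rewrite meanZl; last first.
  apply: bounded_measurableM.
    by apply: (bounded_measurable_comp _ ba); exact: measurable_fst.
  by apply: (bounded_measurable_comp _ bb); exact: measurable_snd.
by rewrite (mean_prodM Q P ba bb) (smooth_r _ smQ g10) (smooth_r _ smP g10) !Kxx; ring.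
Qed.

Let mean_k3k4 : \int[prod_prob nu nu]_z (k3 z * k4 z) =
  (shrink g * shrink (g + 1) * overlap (g + 2)) ^+ 2.
Proof.
rewrite mean_prod; last exact: bMM.
transitivity (\int[nu]_z (shrink g ^+ 2 *
    (K (g + 1) z.1 b * K (g + 1) z.2 a))).
  apply: eq_mean => z; rewrite /k3 /k4 /=.
  under eq_Rintegral do rewrite mulrC.
  rewrite (mean_prodM Q P (bKr z.2 g0) (bKl z.1 g0)).
  by rewrite (smooth_r _ smQ g0) (smooth_l _ smP g0); ring.
have ba := bKr a g10; have bb := bKr b g10.
rewrite meanZl; last first.
  apply: bounded_measurableM.
    by apply: (bounded_measurable_comp _ bb); exact: measurable_fst.
  by apply: (bounded_measurable_comp _ ba); exact: measurable_snd.
rewrite (mean_prodM Q P bb ba) (smooth_r _ smQ g10) (smooth_r _ smP g10).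
rewrite (KC _ b a) -/(overlap _).
by rewrite (_ : g + 1 + 1 = g + 2); ring.
Qed.

Let mean_ksqr (f : (T * T) * (T * T) -> R) (h1 h2 : T * T -> T)
    (m1 m2 : probability T R) (c1 c2 : T) :
  smoothed_by m1 c1 -> smoothed_by m2 c2 ->
  (forall z, f z = K g (h1 z.1) (h2 z.2)) ->
  bounded_measurable f ->
  (forall e : T -> R, bounded_measurable e -> \int[nu]_z e (h1 z) = \int[m1]_x e x) ->
  (forall e : T -> R, bounded_measurable e -> \int[nu]_z e (h2 z) = \int[m2]_x e x) ->
  \int[prod_prob nu nu]_z (f z * f z) = diag * K (g / 2 + 2) c1 c2.
Proof.
move=> sm1 sm2 fE bf H1 H2; rewrite mean_prod; last exact: bMM.
have g210 : 0 < g / 2 + 1 by rewrite addr_gt0.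
transitivity (\int[nu]_z (shrink (g / 2) * K (g / 2 + 1) (h1 z) c2)).
  apply: eq_mean => z; rewrite -(smooth_l _ sm2 g20) -(H2 _ (bKl (h1 z) g20)).
  by apply: eq_mean => z'; rewrite fE /= -expr2 Ksqr.
have bz : bounded_measurable (fun x => shrink (g / 2) * K (g / 2 + 1) x c2).
  by apply: bounded_measurableM; [exact: bounded_measurable_cst|exact: bKr].
rewrite (H1 _ bz) (meanZl _ _ (bKr c2 g210)) (smooth_r _ sm1 g210) (KC _ c2).
by rewrite (_ : g / 2 + 1 + 1 = g / 2 + 2) /diag; ring.
Qed.

(** In the expansion of the square, four products are squares, two involve
    disjoint variables, and four share exactly one variable. *)
Lemma mean_mmd_sqr : \int[prod_prob nu nu]_z mmd z ^+ 2 =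
  2 * diag * (1 + overlap (g / 2 + 2)) +
  2 * (shrink g * shrink (g + 1)) ^+ 2 * (1 + overlap (g + 2) ^+ 2) -
  8 * (shrink g ^+ 2 * shrink ((g + 1) / 2)) * cross_overlap.
Proof.
have e1 e : bounded_measurable e -> \int[nu]_z e z.1 = \int[Q]_x e x.
  exact: mean_prod1.
have e2 e : bounded_measurable e -> \int[nu]_z e z.2 = \int[P]_x e x.
  exact: mean_prod2.
have k11 : \int[prod_prob nu nu]_z (k1 z * k1 z) = diag.
  by rewrite (mean_ksqr (h1 := fst) (h2 := fst) smQ smQ _ bk1 e1 e1)// Kxx mulr1.
have k22 : \int[prod_prob nu nu]_z (k2 z * k2 z) = diag.
  by rewrite (mean_ksqr (h1 := snd) (h2 := snd) smP smP _ bk2 e2 e2)// Kxx mulr1.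
have k33 : \int[prod_prob nu nu]_z (k3 z * k3 z) = diag * overlap (g / 2 + 2).
  by rewrite (mean_ksqr (h1 := fst) (h2 := snd) smQ smP _ bk3 e1 e2).
have k44 : \int[prod_prob nu nu]_z (k4 z * k4 z) = diag * overlap (g / 2 + 2).
  have k4E z : k4 z = K g z.1.2 z.2.1 by exact: KC.
  by rewrite (mean_ksqr (h1 := snd) (h2 := fst) smP smQ k4E bk4 e2 e1) KC.
pose S z := k1 z * k1 z + k2 z * k2 z + (k3 z * k3 z + k4 z * k4 z).
pose C z := k1 z * k2 z + k3 z * k4 z.
pose D z := k1 z * k3 z + k1 z * k4 z + (k2 z * k3 z + k2 z * k4 z).
transitivity (\int[prod_prob nu nu]_z (S z + 2 * C z - 2 * D z)).
  by apply: eq_mean => z; rewrite /mmd /S /C /D /k1 /k2 /k3 /k4 /=; ring.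
have bS : bounded_measurable S.
  by rewrite /S; do 2 apply: bounded_measurableD; exact: bMM.
have bC : bounded_measurable C by rewrite /C; apply: bounded_measurableD; exact: bMM.
have bD : bounded_measurable D.
  by rewrite /D; do 2 apply: bounded_measurableD; exact: bMM.
have b2 (f : (T * T) * (T * T) -> R) : bounded_measurable f ->
    bounded_measurable (fun z => 2 * f z).
  by apply: bounded_measurableM; exact: bounded_measurable_cst.
rewrite meanB; [|by apply: bounded_measurableD => //; exact: b2|exact: b2].
rewrite meanD//; last exact: b2.
rewrite !meanZl//.
have -> : \int[prod_prob nu nu]_z S z = 2 * diag * (1 + overlap (g / 2 + 2)).
  rewrite /S !meanD ?k11 ?k22 ?k33 ?k44; first (by ring);
    by [exact: bMM|apply: bounded_measurableD; exact: bMM].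
have -> : \int[prod_prob nu nu]_z C z =
    (shrink g * shrink (g + 1)) ^+ 2 * (1 + overlap (g + 2) ^+ 2).
  rewrite /C !meanD ?mean_k1k2 ?mean_k3k4; first (by ring); exact: bMM.
have -> : \int[prod_prob nu nu]_z D z =
    4 * (shrink g ^+ 2 * (shrink ((g + 1) / 2) * cross_overlap)).
  rewrite /D !meanD ?mean_k1k3 ?mean_k1k4 ?mean_k2k3 ?mean_k2k4; first (by ring);
    by [exact: bMM|apply: bounded_measurableD; exact: bMM].
by ring.
Qed.

End kernel_moments.

End mmd_moments.

(** * The moment ratio in closed form *)

Section closed_form.
Context {R : realType}.

Definition shrink (d : nat) (s : R) : R := Num.sqrt (s / (s + 1)) ^+ d.

Section gaussian_rbf.
Context {d : nat}.
Implicit Types (x y a b c : d.-tuple R).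

Lemma rbf_midt s x y : 0 < s -> rbf s (midt x y) x = rbf (4 * s) x y.
Proof.
move=> s0; rewrite !rbfE; apply: eq_bigr => i _.
by rewrite tnth_mktuple; congr expR; field; rewrite gt_eqF.
Qed.

Lemma midtC x y : midt x y = midt y x.
Proof. by apply: eq_from_tnth => i; rewrite !tnth_mktuple addrC. Qed.

Lemma gaussian_smoothed_by a b c : c = a \/ c = b ->
  smoothed_by (@rbf R d) (shrink d) a b (gaussian c) c.
Proof.
move=> cab; split=> [s x s0|s s0]; first exact: mean_gaussian_rbf.
have s20 : 0 < s / 2 by rewrite divr_gt0.
have p : 0 < s / 2 + 1 by rewrite addr_gt0.
have br := bounded_measurable_rbf (f := fun=> midt a b) (g := fun x => x) s20
  (measurable_cst _) (@measurable_id _ _ _).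
transitivity (\int[gaussian c]_x (rbf (2 * s) a b * rbf (s / 2) (midt a b) x)).
  by apply: eq_mean => x; rewrite (rbfC s x a) (rbfC s x b) rbf_mul.
rewrite (meanZl _ _ br) (mean_gaussian_rbf _ _ s20).
have -> : rbf (s / 2 + 1) (midt a b) c = rbf (2 * (s + 2)) a b.
  have -> : 2 * (s + 2) = 4 * (s / 2 + 1) by field.
  case: cab => ->; first exact: rbf_midt.
  by rewrite midtC (rbf_midt _ _ p) rbfC.
by rewrite /shrink; ring.
Qed.

Lemma rbf_zerot s x : rbf s x (zerot R d) = expR (- (norm2 x ^+ 2 / (2 * s))).
Proof.
rewrite /rbf; have -> // : subt x (zerot R d) = x.
by apply: eq_from_tnth => i; rewrite !tnth_mktuple subr0.
Qed.

End gaussian_rbf.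

(** Value of the kernel of bandwidth s at two points at squared distance m. *)
Definition decay (m s : R) : R := expR (- (m / (2 * s))).

(** Second moment of the kernel at two independent points with the same law,
    divided by the square of its mean; it behaves like exp (2 d / g^2). *)
Definition full_excess (d : nat) (g : R) : R :=
  Num.sqrt (1 + 4 / (g * (g + 4))) ^+ d.

(** The same quotient for the conditional mean of the kernel given one of the
    points; it behaves like exp (d / (2 g^2)). *)
Definition cond_excess (d : nat) (g : R) : R :=
  Num.sqrt (1 + 1 / ((g + 1) * (g + 3))) ^+ d.

Definition cross_decay (g m : R) : R := decay m (2 * (g + 1)) * decay m (2 * (g + 3)).

(** The variance of u, in units of twice the squared mean (g / (g + 2))^d of the
    kernel at two independent points with the same law; [cond_var] is the
    variance of the conditional mean of u in the same units. *)
Definition full_var (d : nat) (g m : R) : R :=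
  full_excess d g * (1 + decay m (g / 2 + 2)) - (1 + decay m (g + 2) ^+ 2)
  + 4 * decay m (g + 2) - 4 * cond_excess d g * cross_decay g m.

Definition cond_var (d : nat) (g m : R) : R :=
  cond_excess d g * (1 + decay m ((g + 3) / 2) - 2 * cross_decay g m)
  - (1 - decay m (g + 2)) ^+ 2.

Lemma shrink_diag (d : nat) (g : R) : 0 < g ->
  shrink d (g / 2) * shrink d (g / 2 + 1) = (g / (g + 2)) ^+ d * full_excess d g.
Proof.
move=> g0; rewrite /shrink /full_excess -!exprMn; congr (_ ^+ d).
have p2 : 0 < g + 2 by rewrite addr_gt0.
have p4 : 0 < g + 4 by rewrite addr_gt0.
have p20 : 0 < g / 2 by rewrite divr_gt0.
have p21 : 0 < g / 2 + 1 by rewrite addr_gt0.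
have g2 : 0 <= g / (g + 2) by rewrite ltW// divr_gt0.
rewrite -[g / (g + 2) in RHS]ger0_norm// -sqrtr_sqr -!sqrtrM ?sqr_ge0//; last first.
  by rewrite ltW// divr_gt0.
congr Num.sqrt; field.
by rewrite !gt_eqF ?addr_gt0.
Qed.

Lemma shrink_pair (d : nat) (g : R) : 0 < g ->
  (shrink d g * shrink d (g + 1)) ^+ 2 = (g / (g + 2)) ^+ d.
Proof.
move=> g0; rewrite /shrink -!exprMn exprAC; congr (_ ^+ d).
have p1 : 0 < g + 1 by rewrite addr_gt0.
have p2 : 0 < g + 2 by rewrite addr_gt0.
rewrite exprMn !sqr_sqrtr ?divr_ge0 ?addr_ge0 ?(ltW g0)//.
by field; rewrite !gt_eqF ?addr_gt0.
Qed.

Lemma shrink_cond (d : nat) (g : R) : 0 < g ->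
  shrink d g ^+ 2 * shrink d ((g + 1) / 2) = (g / (g + 2)) ^+ d * cond_excess d g.
Proof.
move=> g0; rewrite /shrink /cond_excess exprAC -!exprMn; congr (_ ^+ d).
have p1 : 0 < g + 1 by rewrite addr_gt0.
have p2 : 0 < g + 2 by rewrite addr_gt0.
have p3 : 0 < g + 3 by rewrite addr_gt0.
have g1 : 0 <= g / (g + 1) by rewrite ltW// divr_gt0.
have g2 : 0 <= g / (g + 2) by rewrite ltW// divr_gt0.
rewrite -[g / (g + 2) in RHS]ger0_norm// sqr_sqrtr//.
rewrite -[g / (g + 1)]ger0_norm// -!sqrtr_sqr -!sqrtrM ?sqr_ge0//.
congr Num.sqrt; field.
by rewrite !gt_eqF ?addr_gt0.
Qed.

Lemma rho_MMDE (d : nat) (g : R) (mu : d.-tuple R)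
    dO (Omega : measurableType dO) (Pr : probability Omega R)
    (X1 X2 Y1 Y2 : {RV Pr >-> d.-tuple R}) : 0 < g ->
  is_mmd_sample (gaussian (zerot R d)) (gaussian mu) X1 X2 Y1 Y2 ->
  rho_MMD g X1 X2 Y1 Y2 =
  Num.sqrt (full_var d g (norm2 mu ^+ 2)) / Num.sqrt (cond_var d g (norm2 mu ^+ 2)).
Proof.
move=> g0 [indep [lX1 lX2] [lY1 lY2]].
set m := norm2 mu ^+ 2.
have law12 := independent_pairs_law indep lX1 lX2 lY1 lY2.
have bK (s : R) : 0 < s ->
    bounded_measurable (fun z : d.-tuple R * d.-tuple R => rbf s z.1 z.2).
  by move=> s0; apply: bounded_measurable_rbf.
have smQ : smoothed_by (@rbf R d) (shrink d) mu (zerot R d) (gaussian mu) mu.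
  by apply: gaussian_smoothed_by; left.
have smP : smoothed_by (@rbf R d) (shrink d) mu (zerot R d)
    (gaussian (zerot R d)) (zerot R d).
  by apply: gaussian_smoothed_by; right.
have bu := bounded_measurable_mmd g0 bK.
rewrite /rho_MMD (moment_ratioE law12 bu).
rewrite (variance_cond_mmd g0 bK (@rbfC R d) (@rbfxx R d) (@rbf_sqr R d) smQ smP).
rewrite (mean_mmd_sqr g0 bK (@rbfC R d) (@rbfxx R d) (@rbf_sqr R d) smQ smP).
rewrite (mean_mmd g0 bK (@rbfC R d) (@rbfxx R d) smQ smP).
rewrite !rbf_zerot -/m -!/(decay m _).
set c := (g / (g + 2)) ^+ d.
have c0 : 0 < 2 * c by rewrite mulr_gt0// exprn_gt0// divr_gt0// addr_gt0.
set u1 := shrink d g; set u2 := shrink d (g + 1).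
have e1 : (u1 * u2) ^+ 2 = c by exact: shrink_pair.
have e2 : shrink d (g / 2) * shrink d (g / 2 + 1) = c * full_excess d g.
  exact: shrink_diag.
have e3 : u1 ^+ 2 * shrink d ((g + 1) / 2) = c * cond_excess d g.
  exact: shrink_cond.
rewrite e1 e2 e3.
set E4 := decay m (g / 2 + 2); set E := decay m (g + 2).
set E3 := decay m ((g + 3) / 2); set X := decay m (2 * (g + 1)) * _.
have -> : 2 * (c * full_excess d g) * (1 + E4) + 2 * c * (1 + E ^+ 2) -
    8 * (c * cond_excess d g) * X - (2 * (u1 * u2) * (1 - E)) ^+ 2 =
    2 * c * full_var d g m.
  have -> : (2 * (u1 * u2) * (1 - E)) ^+ 2 = 4 * (u1 * u2) ^+ 2 * (1 - E) ^+ 2.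
    by ring.
  by rewrite e1 /full_var /cross_decay -/E -/E4 -/X; ring.
have -> : 2 * u1 ^+ 2 * (shrink d ((g + 1) / 2) * (1 + E3 - 2 * X) -
    (u2 * (1 - E)) ^+ 2) = 2 * c * cond_var d g m.
  transitivity (2 * (u1 ^+ 2 * shrink d ((g + 1) / 2)) * (1 + E3 - 2 * X) -
     2 * (u1 * u2) ^+ 2 * (1 - E) ^+ 2); first by ring.
  by rewrite e1 e3 /cond_var /cross_decay -/E -/E3 -/X; ring.
rewrite (sqrtrM _ (ltW c0)) (sqrtrM (cond_var d g m) (ltW c0)).
by rewrite -mulf_div divff ?mul1r// gt_eqF// sqrtr_gt0.
Qed.

End closed_form.

(** * Bounds on the decay and excess factors *)

Section estimates.
Context {R : realType}.

Section decay_bounds.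
Variables g m : R.
Hypotheses (g0 : 0 < g) (m0 : 0 <= m).

Let e := decay m (g + 2).
Let e3 := decay m ((g + 3) / 2).
Let e4 := decay m (g / 2 + 2).
Let X := cross_decay g m.

Let p1 : 0 < g + 1. Proof. by rewrite addr_gt0. Qed.
Let p2 : 0 < g + 2. Proof. by rewrite addr_gt0. Qed.
Let p3 : 0 < g + 3. Proof. by rewrite addr_gt0. Qed.
Let p4 : 0 < g + 4. Proof. by rewrite addr_gt0. Qed.

Lemma decay_gt0 s : 0 < decay m s :> R. Proof. exact: expR_gt0. Qed.

Lemma decay_le1 s : 0 < s -> decay m s <= 1 :> R.
Proof.
by move=> s0; rewrite expR_le1 oppr_le0 divr_ge0// mulr_ge0// ltW.
Qed.

Lemma expRN_ge1B (t : R) : 1 - t <= expR (- t).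
Proof. by have := expR_ge1Dx (- t). Qed.

Lemma expRN_le (t : R) : 0 <= t -> expR (- t) <= (1 + t)^-1.
Proof.
move=> t0; rewrite expRN lef_pV2 ?posrE ?expR_gt0 ?ltr_wpDr//.
exact: expR_ge1Dx.
Qed.

Lemma mulr_defect_le (x t E : R) : 0 <= x -> x <= 1 -> 0 <= t -> 1 - t <= E ->
  x - x * E <= t.
Proof.
move=> x0 x1 t0 tE.
have h1 : 0 <= x * (E - (1 - t)) by rewrite mulr_ge0// subr_ge0.
have h2 : 0 <= t * (1 - x) by rewrite mulr_ge0// subr_ge0.
lra.
Qed.

(** The exponents of the decay factors differ by quantities that are small
    compared with m / g: these are the differences with the exponent of
    [decay m (g + 2)], or with twice that exponent. *)
Definition theta3 : R := m / ((g + 2) * (g + 3)).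
Definition theta4 : R := 2 * m / ((g + 2) * (g + 4)).
Definition delta : R := m / (2 * ((g + 1) * (g + 2) * (g + 3))).

Let theta3_ge0 : 0 <= theta3. Proof. by rewrite divr_ge0// mulr_ge0// ltW. Qed.
Let theta4_ge0 : 0 <= theta4. Proof. by rewrite divr_ge0 ?mulr_ge0// ltW. Qed.
Let delta_ge0 : 0 <= delta. Proof. by rewrite divr_ge0 ?mulr_ge0// ltW. Qed.

Lemma decay3E : e3 * expR (- theta3) = e ^+ 2.
Proof.
rewrite /e3 /e /decay -expRM_natr -expRD; congr expR; rewrite /theta3.
by field; rewrite !gt_eqF.
Qed.

Lemma decay4E : e4 * expR (- theta4) = e ^+ 2.
Proof.
rewrite /e4 /e /decay -expRM_natr -expRD; congr expR; rewrite /theta4.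
by field; rewrite !gt_eqF ?addr_gt0.
Qed.

Lemma cross_decayE : X = e * expR (- delta).
Proof.
rewrite /X /cross_decay /e /decay -!expRD; congr expR; rewrite /delta.
by field; rewrite !gt_eqF.
Qed.

Lemma cross_decay_gt0 : 0 < X. Proof. by rewrite mulr_gt0 ?decay_gt0. Qed.

Lemma cross_decay_le : X <= e.
Proof.
by rewrite cross_decayE ler_piMr ?(ltW (decay_gt0 _))// expR_le1 oppr_le0.
Qed.

Lemma cross_decay_ge : e - X <= delta.
Proof.
rewrite cross_decayE; apply: mulr_defect_le => //; first exact/ltW/decay_gt0.
  exact: decay_le1.
exact: expRN_ge1B.
Qed.

(** Both bounds come from 1 - t <= exp (- t) <= 1 / (1 + t) for t >= 0, applied
    to e3 exp (- theta3) = e^2; they hold for all m >= 0. *)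
Lemma decay3_bounds : e ^+ 2 * theta3 <= e3 - e ^+ 2 <= theta3.
Proof.
have e3le : e3 <= 1 by apply: decay_le1; rewrite divr_gt0.
have e3gt : 0 < e3 := decay_gt0 _.
have E := decay3E; have H2 := expRN_le theta3_ge0.
apply/andP; split; last first.
  by rewrite -E; apply: mulr_defect_le; rewrite ?(ltW e3gt)// expRN_ge1B.
have : e3 * expR (- theta3) * (1 + theta3) <= e3.
  rewrite -mulrA ler_piMr ?(ltW e3gt)//.
  by rewrite -ler_pdivlMr ?ltr_wpDr// div1r.
by rewrite E => ?; lra.
Qed.

Lemma decay4_bounds : e ^+ 2 * theta4 <= e4 - e ^+ 2 <= theta4.
Proof.
have e4le : e4 <= 1 by apply: decay_le1; rewrite addr_gt0// divr_gt0.
have e4gt : 0 < e4 := decay_gt0 _.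
have E := decay4E; have H2 := expRN_le theta4_ge0.
apply/andP; split; last first.
  by rewrite -E; apply: mulr_defect_le; rewrite ?(ltW e4gt)// expRN_ge1B.
have : e4 * expR (- theta4) * (1 + theta4) <= e4.
  rewrite -mulrA ler_piMr ?(ltW e4gt)//.
  by rewrite -ler_pdivlMr ?ltr_wpDr// div1r.
by rewrite E => ?; lra.
Qed.

(** In terms of exponents, the mean of 1 / (g + 1) and 1 / (g + 3) is at least
    1 / (g + 4). *)
Lemma cross_decay_sqr : X ^+ 2 <= e4.
Proof.
rewrite /X /cross_decay /e4 /decay -expRD -expRM_natr ler_expR.
rewrite [leLHS](_ : _ = - (m * ((g + 2) / ((g + 1) * (g + 3))))); last first.
  by field; rewrite !gt_eqF.
rewrite lerN2 ler_wpM2l//.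
rewrite -subr_ge0 [X in 0 <= X](_ : _ =
  (2 * g + 5) / ((g + 1) * (g + 3) * (g + 4))); last first.
  by field; rewrite !gt_eqF ?addr_gt0.
rewrite divr_ge0// ?mulr_ge0 ?(ltW p1) ?(ltW p3) ?(ltW p4)//.
by rewrite addr_ge0// mulr_ge0// ltW.
Qed.

Lemma decay2_ge : 1 - m / (2 * (g + 2)) <= e.
Proof. exact: expRN_ge1B. Qed.

Lemma decay2_le : e <= (1 + m / (2 * (g + 2)))^-1.
Proof. by apply: expRN_le; rewrite divr_ge0// mulr_ge0// ltW. Qed.

End decay_bounds.

Lemma exp3_1D_le (x y : R) : 0 < y -> y <= 8^-1 -> y <= x ->
  (1 + y) ^+ 3 <= 1 + 4 * x.
Proof.
move=> y0 y8 yx.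
have h1 : 0 <= y * (8^-1 - y) by rewrite mulr_ge0 ?subr_ge0// ltW.
have h2 : 0 <= y * (y * (8^-1 - y)) by rewrite !mulr_ge0 ?subr_ge0// ltW.
by rewrite !exprS expr0; lra.
Qed.

Section excess_bounds.
Variables (d : nat) (g : R).
Hypothesis g1 : 1 <= g.

Let g0 : 0 < g. Proof. exact: lt_le_trans g1. Qed.
Let x4 : R := (g * (g + 4))^-1.
Let y3 : R := ((g + 1) * (g + 3))^-1.

Let x4_gt0 : 0 < x4. Proof. by rewrite invr_gt0 mulr_gt0// addr_gt0. Qed.
Let y3_gt0 : 0 < y3. Proof. by rewrite invr_gt0 mulr_gt0// addr_gt0. Qed.
Let y3x4 : y3 <= x4.
Proof. by rewrite lef_pV2 ?posrE ?mulr_gt0 ?addr_gt0//; nra. Qed.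
Let y3_le : y3 <= 8^-1.
Proof.
rewrite /y3 lef_pV2 ?posrE ?mulr_gt0 ?addr_gt0//.
have h : 0 <= (g - 1) * (g + 5) by rewrite mulr_ge0 ?subr_ge0// addr_ge0// ltW.
lra.
Qed.
Let y3_ge : (8 * g ^+ 2)^-1 <= y3.
Proof.
rewrite /y3 lef_pV2 ?posrE ?mulr_gt0 ?addr_gt0 ?exprn_gt0// expr2.
have h : 0 <= (g - 1) * (7 * g + 3).
  by rewrite mulr_ge0 ?subr_ge0// addr_ge0// mulr_ge0// ltW.
lra.
Qed.
Let x4_le : x4 <= (g ^+ 2)^-1.
Proof.
rewrite /x4 lef_pV2 ?posrE ?mulr_gt0 ?addr_gt0 ?exprn_gt0// expr2.
by rewrite ler_wpM2l ?(ltW g0)// lerDl.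
Qed.

Let A := full_excess d g.
Let B := cond_excess d g.

Lemma full_excess_sqr : A ^+ 2 = (1 + 4 * x4) ^+ d.
Proof.
by rewrite /A /full_excess exprAC sqr_sqrtr// addr_ge0// mulr_ge0// ltW.
Qed.

Lemma cond_excess_sqr : B ^+ 2 = (1 + y3) ^+ d.
Proof.
rewrite /B /cond_excess exprAC sqr_sqrtr ?div1r//.
by rewrite addr_ge0// ltW.
Qed.

Lemma cond_excess_ge1 : 1 <= B.
Proof.
rewrite /B /cond_excess exprn_ege1// -[leLHS]sqrtr1 ler_sqrt.
  by rewrite div1r lerDl ltW.
by rewrite div1r addr_ge0// ltW.
Qed.

(** To leading order A behaves like B^4, and the cube leaves room for the
    lower-order terms. A square would be too weak for [full_var_lb_small]: the
    polynomial of its proof would become 2 + 2 X^2 - 4 X, which vanishes at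
    X = 1. *)
Lemma cond_excess_cube : B ^+ 3 <= A.
Proof.
have B1 := cond_excess_ge1.
have A0 : 0 <= A by rewrite exprn_ge0// sqrtr_ge0.
have B0 : 0 <= B by lra.
rewrite -(ler_pXn2r (n := 2))// ?nnegrE ?exprn_ge0//.
rewrite -exprM mulnC exprM cond_excess_sqr full_excess_sqr -exprM mulnC exprM.
apply: lerXn2r; rewrite ?nnegrE.
- by rewrite exprn_ge0// addr_ge0// ltW.
- by rewrite addr_ge0// mulr_ge0// ltW.
- exact: exp3_1D_le.
Qed.

Lemma full_excess_le : A <= expR (2 * (d%:R / g ^+ 2)).
Proof.
have A0 : 0 <= A by rewrite exprn_ge0// sqrtr_ge0.
rewrite -(ler_pXn2r (n := 2))// ?nnegrE ?expR_ge0//.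
rewrite full_excess_sqr -expRM_natr.
apply: (@le_trans _ _ (expR (4 * x4) ^+ d)).
  apply: lerXn2r; rewrite ?nnegrE ?expR_ge0 ?expR_ge1Dx//.
  by rewrite addr_ge0// mulr_ge0// ltW.
rewrite -expRM_natr ler_expR.
have d0 : 0 <= d%:R :> R by [].
by have := ler_wpM2l d0 x4_le; lra.
Qed.

Lemma full_excess_le_lin : d%:R / g ^+ 2 <= 4^-1 -> A - 1 <= 4 * (d%:R / g ^+ 2).
Proof.
have q0 : 0 <= d%:R / g ^+ 2 by rewrite divr_ge0// exprn_ge0// ltW.
move: full_excess_le; set q := d%:R / g ^+ 2 in q0 *.
move=> Aq q4; have := expRN_ge1B (2 * q).
have e0 : 0 < expR (2 * q) by exact: expR_gt0.
rewrite expRN => H.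
have : expR (2 * q) * (1 - 2 * q) <= 1.
  by rewrite -ler_pdivlMl// mulr1.
nra.
Qed.

Lemma cond_excess_sqr_ge : 1 + d%:R / g ^+ 2 / 8 <= B ^+ 2.
Proof.
rewrite cond_excess_sqr.
apply: (@le_trans _ _ (1 + d%:R * y3)).
  by rewrite lerD2l -mulrA -invfM ler_wpM2l// mulrC; exact: y3_ge.
elim: d => [|n IHn]; first by rewrite mulr0n mul0r addr0 expr0.
rewrite exprS.
apply: (@le_trans _ _ ((1 + y3) * (1 + n%:R * y3))).
  rewrite -natr1; have n0 : 0 <= n%:R :> R by []. 
  nra.
by rewrite ler_wpM2l// addr_ge0// ltW.
Qed.

End excess_bounds.

(** * Two-sided bounds on the ratio of the variances *)

Lemma ratio_bounds (k1 k2 l1 l2 w z F C : R) :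
  0 <= k1 -> 0 < l1 -> 0 < l2 -> 0 <= w -> 0 < z ->
  k1 * w <= F -> F <= k2 * w -> l1 * z <= C -> C <= l2 * z ->
  k1 / l2 * (w / z) <= F / C /\ F / C <= k2 / l1 * (w / z).
Proof.
move=> k10 l10 l20 w0 z0 Flb Fub Clb Cub.
have C0 : 0 < C by apply: lt_le_trans Clb; exact: mulr_gt0.
have F0 : 0 <= F by apply: le_trans Flb; exact: mulr_ge0.
have lz1 : 0 < l1 * z by exact: mulr_gt0.
have lz2 : 0 < l2 * z by exact: mulr_gt0.
rewrite !mulf_div; split.
  rewrite ler_pdivrMr// mulrAC ler_pdivlMr//.
  by apply: ler_pM => //; [exact: mulr_ge0|exact: ltW].
rewrite ler_pdivrMr// mulrAC ler_pdivlMr//.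
by apply: ler_pM => //; exact: ltW.
Qed.

Section variance_bounds.
Variables (d : nat) (g m : R).
Hypotheses (g1 : 1 <= g) (m0 : 0 <= m).

Let g0 : 0 < g. Proof. exact: lt_le_trans g1. Qed.
Let p1 : 0 < g + 1. Proof. by rewrite addr_gt0. Qed.
Let p2 : 0 < g + 2. Proof. by rewrite addr_gt0. Qed.
Let p3 : 0 < g + 3. Proof. by rewrite addr_gt0. Qed.
Let p4 : 0 < g + 4. Proof. by rewrite addr_gt0. Qed.

Let A := full_excess d g.
Let B := cond_excess d g.
Let e := decay m (g + 2).
Let e3 := decay m ((g + 3) / 2).
Let e4 := decay m (g / 2 + 2).
Let X := cross_decay g m.
Let F := full_var d g m.
Let C := cond_var d g m.
Let q := d%:R / g ^+ 2.
Let K := 1 + e3 - 2 * X.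

Let FE : F = A * (1 + e4) - (1 + e ^+ 2) + 4 * e - 4 * B * X.
Proof. by []. Qed.
Let CE : C = B * K - (1 - e) ^+ 2.
Proof. by []. Qed.

Let e_gt0 : 0 < e. Proof. exact: decay_gt0. Qed.
Let e_le1 : e <= 1. Proof. exact: decay_le1. Qed.
Let e3_le1 : e3 <= 1. Proof. by apply: decay_le1 => //; rewrite divr_gt0. Qed.
Let e4_gt0 : 0 < e4. Proof. exact: decay_gt0. Qed.
Let e4_le1 : e4 <= 1.
Proof. by apply: decay_le1 => //; rewrite addr_gt0// divr_gt0. Qed.
Let X_gt0 : 0 < X. Proof. exact: cross_decay_gt0. Qed.
Let X_le : X <= e. Proof. exact: cross_decay_le. Qed.
Let B1 : 1 <= B. Proof. exact: cond_excess_ge1. Qed.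
Let B0 : 0 <= B. Proof. exact: le_trans B1. Qed.
Let B3 : B ^+ 3 <= A. Proof. exact: cond_excess_cube. Qed.

Let B_le_A : B <= A.
Proof.
apply: le_trans B3; rewrite !exprS expr0 mulr1 ler_peMr//.
have := mulr_ge0 (_ : 0 <= B - 1) (_ : 0 <= B - 1); rewrite subr_ge0 => /(_ B1 B1).
by have := B1; lra.
Qed.

Let A0 : 0 < A. Proof. exact: lt_le_trans (lt_le_trans ltr01 B1) B_le_A. Qed.

Let A_excess : 3 * (B - 1) <= A - 1.
Proof.
have h : 0 <= (B - 1) * (B - 1) * (B + 2).
  by rewrite !mulr_ge0 ?subr_ge0// addr_ge0.
by have := B3; rewrite !exprS expr0; lra.
Qed.

Let g2_gt0 : 0 < g ^+ 2. Proof. exact: exprn_gt0. Qed.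
Let mg0 : 0 <= m / g ^+ 2. Proof. by rewrite divr_ge0// ltW. Qed.

Let theta3_le : theta3 g m <= m / g ^+ 2.
Proof.
rewrite /theta3 ler_wpM2l// lef_pV2 ?posrE ?mulr_gt0//.
have := g0; rewrite expr2; lra.
Qed.

Let theta3_ge : m / g ^+ 2 / 12 <= theta3 g m.
Proof.
rewrite /theta3 -mulrA -invfM ler_wpM2l// lef_pV2 ?posrE ?mulr_gt0//.
have h : 0 <= (g - 1) * (11 * g + 6) by rewrite mulr_ge0 ?subr_ge0//; have := g0; lra.
rewrite expr2; lra.
Qed.

Let theta4_le : theta4 g m <= 2 * (m / g ^+ 2).
Proof.
rewrite /theta4 -mulrA ler_wpM2l// ler_wpM2l// lef_pV2 ?posrE ?mulr_gt0//.
have := g0; rewrite expr2; lra.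
Qed.

Let theta4_ge : 2 * (m / g ^+ 2) / 15 <= theta4 g m.
Proof.
rewrite /theta4 -!mulrA ler_wpM2l// -invfM ler_wpM2l// lef_pV2 ?posrE ?mulr_gt0//.
have h : 0 <= (g - 1) * (14 * g + 8) by rewrite mulr_ge0 ?subr_ge0//; have := g0; lra.
rewrite expr2; lra.
Qed.

Let delta_le : 2 * delta g m <= m / g ^+ 2.
Proof.
rewrite /delta invfM mulrCA (mulrA 2) divff// mul1r ler_wpM2l//.
rewrite lef_pV2 ?posrE ?mulr_gt0//.
have h : 0 <= g * (g * g) by rewrite !mulr_ge0 ?(ltW g0).
have h2 : 0 <= g * g by rewrite mulr_ge0 ?(ltW g0).
have := g0; rewrite expr2; lra.
Qed.

Lemma full_var_ub : F <= 6 * A.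
Proof.
rewrite FE.
have h1 : 0 <= A * (1 - e4).
  by rewrite mulr_ge0 ?subr_ge0// ltW.
have h2 : 0 <= B * X by rewrite mulr_ge0 ?(ltW X_gt0).
have h3 := sqr_ge0 e.
have := B1; have := B_le_A; have := e_le1; lra.
Qed.

(** The negative terms of F are at most 4 B + 2, which is dwarfed by A >= B^3. *)
Lemma full_var_lb_large : 16 <= B -> A / 2 <= F.
Proof.
move=> B16; rewrite FE.
have h1 : 0 <= A * e4 by rewrite mulr_ge0 ?ltW.
have h2 : 0 <= B * (1 - X).
  by rewrite mulr_ge0 ?subr_ge0// (le_trans X_le).
have h3 : e ^+ 2 <= 1 by rewrite expr_le1// ltW.
have h4 : 0 <= (B - 16) * (B * (B + 16)).
  by rewrite !mulr_ge0 ?subr_ge0// ?addr_ge0.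
have := B3; rewrite !exprS expr0 mulr1 => h5.
have := e_gt0; lra.
Qed.

(** Write F = (A - 1) (1 + e4) - 4 (B - 1) X + (e4 - e^2) + 4 (e - X). As
    A - 1 >= 3 (B - 1) and e4 >= X^2, the first two terms are at least
    (B - 1) (3 + 3 X^2 - 4 X), and 3 + 3 X^2 - 4 X = 3 (X - 2/3)^2 + 5/3. *)
Lemma full_var_lb_small : 5 / 3 * (B - 1) + e ^+ 2 * theta4 g m <= F.
Proof.
have /andP[h1 _] := decay4_bounds g0 m0.
have hX := cross_decay_sqr g0 m0.
have h2 : 0 <= (A - 1 - 3 * (B - 1)) * (1 + e4).
  by rewrite mulr_ge0 ?subr_ge0// addr_ge0// ltW.
have h3 : 0 <= (B - 1) * (3 * (e4 - X ^+ 2)).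
  by rewrite mulr_ge0 ?subr_ge0// mulr_ge0// subr_ge0.
have h4 : 0 <= (B - 1) * (3 * (X - 2 / 3) ^+ 2).
  by rewrite mulr_ge0 ?subr_ge0// mulr_ge0// sqr_ge0.
rewrite FE -/e4 -/e in h1 *; have := X_le; move: h3 h4; rewrite !expr2 => *.
lra.
Qed.

Lemma full_var_ub_small : F <= 2 * (A - 1) + theta4 g m + 4 * delta g m.
Proof.
have /andP[_ h1] := decay4_bounds g0 m0.
have h2 := cross_decay_ge g0 m0.
have h3 : 0 <= (A - 1) * (1 - e4).
  by rewrite mulr_ge0 ?subr_ge0// (le_trans B1).
have h4 : 0 <= (B - 1) * X by rewrite mulr_ge0 ?subr_ge0// ltW.
rewrite FE; rewrite -/e4 -/e -/X in h1 h2; lra.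
Qed.

(** K - (1 - e)^2 = (e3 - e^2) + 2 (e - X). *)
Let gapK : e ^+ 2 * theta3 g m <= K - (1 - e) ^+ 2 <= theta3 g m + 2 * delta g m.
Proof.
have /andP[h1 h2] := decay3_bounds g0 m0.
have h3 := cross_decay_ge g0 m0.
rewrite -/e3 -/e -/X in h1 h2 h3; rewrite /K; have := X_le.
move: h1 h2; rewrite !expr2 => *; apply/andP; split; lra.
Qed.

(** C = (B - 1) K + (K - (1 - e)^2), and K >= (1 - e)^2. *)
Lemma cond_var_lb : (B - 1) * (1 - e) ^+ 2 + e ^+ 2 * theta3 g m <= C.
Proof.
have /andP[h1 _] := gapK.
have t0 : 0 <= e ^+ 2 * theta3 g m.
  rewrite mulr_ge0 ?sqr_ge0//; apply: le_trans theta3_ge.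
  by rewrite divr_ge0.
have h2 : 0 <= (B - 1) * (K - (1 - e) ^+ 2).
  by rewrite mulr_ge0 ?subr_ge0// -subr_ge0 (le_trans t0).
rewrite CE; lra.
Qed.

Let e_gap_ub : 1 - e <= m / (2 * g).
Proof.
have := decay2_ge g m; rewrite -/e => h.
have : m / (2 * (g + 2)) <= m / (2 * g).
  rewrite ler_wpM2l// lef_pV2 ?posrE ?mulr_gt0//; lra.
lra.
Qed.

Let K_ub : K <= m ^+ 2 / g ^+ 2 / 4 + 2 * (m / g ^+ 2).
Proof.
have /andP[_ h1] := gapK.
have h2 : (1 - e) ^+ 2 <= (m / (2 * g)) ^+ 2.
  apply: lerXn2r; rewrite ?nnegrE ?subr_ge0//.
  by rewrite divr_ge0// mulr_ge0// ltW.
have h3 : (m / (2 * g)) ^+ 2 = m ^+ 2 / g ^+ 2 / 4 by field; rewrite gt_eqF.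
rewrite h3 in h2; have := theta3_le; have := delta_le; lra.
Qed.

Lemma cond_var_ub_small :
  C <= (B - 1) * (m ^+ 2 / g ^+ 2 / 4 + 2 * (m / g ^+ 2)) + 2 * (m / g ^+ 2).
Proof.
have /andP[_ h1] := gapK.
have h2 : 0 <= (B - 1) * (m ^+ 2 / g ^+ 2 / 4 + 2 * (m / g ^+ 2) - K).
  by rewrite mulr_ge0 ?subr_ge0.
rewrite CE; have := theta3_le; have := delta_le; lra.
Qed.

Lemma cond_var_ub : C <= B * (m ^+ 2 / g ^+ 2 / 4 + 2 * (m / g ^+ 2)).
Proof.
have h2 : 0 <= B * (m ^+ 2 / g ^+ 2 / 4 + 2 * (m / g ^+ 2) - K).
  by rewrite mulr_ge0 ?subr_ge0.
rewrite CE; have := sqr_ge0 (1 - e); lra.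
Qed.

Lemma cond_var_ub2 : C <= 2 * B.
Proof.
have h2 : 0 <= B * (2 - K).
  rewrite mulr_ge0 ?subr_ge0// /K.
  have := e3_le1; have := X_gt0; lra.
rewrite CE; have := sqr_ge0 (1 - e); lra.
Qed.

Section decay_close_to_one.
Hypothesis mg : m <= g.

Lemma decay_gap_lb : (m / (12 * g)) ^+ 2 <= (1 - e) ^+ 2.
Proof.
apply: lerXn2r; rewrite ?nnegrE ?subr_ge0//.
  by rewrite divr_ge0// mulr_ge0// ltW.
have := decay2_le g0 m0; rewrite -/e; set t := m / (2 * (g + 2)) => et.
have t0 : 0 <= t by rewrite divr_ge0// mulr_ge0// ltW.
have t1 : t <= 1.
  rewrite ler_pdivrMr ?mulr_gt0// mul1r (le_trans mg)//; have := g0; lra.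
have h : t / 2 <= 1 - (1 + t)^-1.
  rewrite -subr_ge0 [X in 0 <= X](_ : _ = t * (1 - t) / (2 * (1 + t))); last first.
    by field; rewrite gt_eqF// ltr_wpDr.
  have h1 : 0 <= t * (1 - t) by apply: mulr_ge0; rewrite ?subr_ge0.
  by apply: divr_ge0 => //; apply: mulr_ge0 => //; apply: addr_ge0.
have : m / (12 * g) <= t / 2.
  rewrite /t -mulrA -invfM ler_wpM2l// lef_pV2 ?posrE ?mulr_gt0//.
  have := g1; lra.
lra.
Qed.

Lemma decay_ge_half : 4^-1 <= e ^+ 2.
Proof.
have -> : 4^-1 = 2^-1 ^+ 2 :> R by field.
apply: lerXn2r; rewrite ?nnegrE ?invr_ge0 ?(ltW e_gt0)//.
have := decay2_ge g m; rewrite -/e => h.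
have : m / (2 * (g + 2)) <= 2^-1.
  by rewrite ler_pdivrMr ?mulr_gt0// (le_trans mg)//; have := g0; lra.
lra.
Qed.

End decay_close_to_one.

Lemma decay_gap_far : 6 * g <= m -> 4^-1 <= (1 - e) ^+ 2.
Proof.
move=> gm.
have -> : 4^-1 = 2^-1 ^+ 2 :> R by field.
apply: lerXn2r; rewrite ?nnegrE ?invr_ge0 ?subr_ge0//.
have := decay2_le g0 m0; rewrite -/e; set t := m / (2 * (g + 2)) => et.
have t1 : 1 <= t.
  by rewrite ler_pdivlMr ?mulr_gt0// mul1r; have := g1; lra.
have : (1 + t)^-1 <= 2^-1 by rewrite lef_pV2 ?posrE; lra.
lra.
Qed.

(** From B^2 >= 1 + q / 8, which is where the threshold 8 * 16^2 comes from. *)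
Lemma cond_excess_large : 8 * 16 ^+ 2 <= q -> 16 <= B.
Proof.
move=> q2; rewrite expr2 in q2; have := cond_excess_sqr_ge d g1; rewrite -/B -/q => h.
rewrite -(ler_pXn2r (n := 2))// ?nnegrE//.
by rewrite expr2; lra.
Qed.

(** (1 + s / 24)^2 <= 1 + s / 8 as long as s <= 24. *)
Lemma cond_excess_lb (s : R) : 0 <= s -> s <= q -> s <= 24 -> s / 24 <= B - 1.
Proof.
move=> s0 sq s24; have := cond_excess_sqr_ge d g1; rewrite -/B -/q => h.
suff : 1 + s / 24 <= B by lra.
rewrite -(ler_pXn2r (n := 2))// ?nnegrE//; last first.
  by rewrite addr_ge0// divr_ge0.
have : 0 <= s * (24 - s) by rewrite mulr_ge0 ?subr_ge0.
by rewrite expr2; lra.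
Qed.

Lemma cond_var_lb0 : (B - 1) * (1 - e) ^+ 2 <= C.
Proof.
have t0 : 0 <= e ^+ 2 * theta3 g m.
  apply: mulr_ge0; first exact: sqr_ge0.
  by apply: le_trans theta3_ge; exact: divr_ge0.
have := cond_var_lb; lra.
Qed.

Lemma full_var_ge0 : 0 <= F.
Proof.
have t0 : 0 <= e ^+ 2 * theta4 g m.
  apply: mulr_ge0; first exact: sqr_ge0.
  by apply: le_trans theta4_ge; apply: divr_ge0 => //; exact: mulr_ge0.
have := full_var_lb_small; have := B1; lra.
Qed.

Lemma cond_var_ge0 : 0 <= C.
Proof.
apply: le_trans cond_var_lb0; apply: mulr_ge0; last exact: sqr_ge0.
by rewrite subr_ge0.
Qed.

(** The means are so far apart that (1 - e)^2 is bounded below: F is of order A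
    and C of order B. *)
Lemma var_ratio_far : 8 * 16 ^+ 2 <= q -> 6 * g <= m ->
  4^-1 * (A / B) <= F / C /\ F / C <= 48 * (A / B).
Proof.
move=> q2 gm; have B16 := cond_excess_large q2.
have Bgt0 : 0 < B by lra.
have Clb : 8^-1 * B <= C.
  have h := decay_gap_far gm.
  have h2 : 0 <= (B - 1) * ((1 - e) ^+ 2 - 4^-1).
    by apply: mulr_ge0; rewrite subr_ge0.
  have := cond_var_lb0; lra.
have Fub := full_var_ub; have Flb := full_var_lb_large B16; have Cub := cond_var_ub2.
rewrite mulrC in Flb.
have := ratio_bounds _ _ _ (ltW A0) Bgt0 Flb Fub Clb Cub.
rewrite (_ : 2^-1 / 2 = 4^-1); last by field.
rewrite (_ : 6 / 8^-1 = 48); last by field.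
by apply => //; rewrite ?invr_ge0 ?invr_gt0.
Qed.

(** Here 1 - e is of order m / g, and so is the square root of K: the terms of
    order m / g^2 in K are absorbed by m^2 / g^2 because m >= c. *)
Lemma var_ratio_near (c : R) : 0 < c -> c <= m -> 8 * 16 ^+ 2 <= q -> m <= g ->
  2^-1 / (4^-1 + 2 / c) * (A / B * (g / m) ^+ 2) <= F / C /\
  F / C <= 6 / (2 * 144)^-1 * (A / B * (g / m) ^+ 2).
Proof.
move=> c0 cm q2 mg; have B16 := cond_excess_large q2.
have Bgt0 : 0 < B by lra.
have mgt0 : 0 < m by exact: lt_le_trans cm.
have r0 : 0 < (m / g) ^+ 2 by rewrite exprn_gt0// divr_gt0.
have k0 : 0 < 4^-1 + 2 / c by rewrite addr_gt0// ?invr_gt0// divr_gt0.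
have z0 : 0 < B * (m / g) ^+ 2 by exact: mulr_gt0.
have Clb : (2 * 144)^-1 * (B * (m / g) ^+ 2) <= C.
  have h := decay_gap_lb mg.
  have h2 : 0 <= (B - 1) * ((1 - e) ^+ 2 - (m / (12 * g)) ^+ 2).
    by apply: mulr_ge0; rewrite subr_ge0.
  have h3 : (m / (12 * g)) ^+ 2 = (m / g) ^+ 2 / 144 by field; rewrite gt_eqF.
  have h4 : 0 <= (B - 2) * (m / g) ^+ 2.
    by apply: mulr_ge0; [rewrite subr_ge0; lra|exact: ltW].
  rewrite h3 in h2; have := cond_var_lb0; lra.
have Cub : C <= (4^-1 + 2 / c) * (B * (m / g) ^+ 2).
  apply: le_trans cond_var_ub _.
  rewrite [leRHS]mulrCA; apply: ler_wpM2l => //.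
  have : m / g ^+ 2 <= (m / g) ^+ 2 / c.
    rewrite ler_pdivlMr// expr_div_n mulrAC ler_wpM2r ?invr_ge0 ?(ltW g2_gt0)//.
    by rewrite expr2 ler_wpM2l.
  by rewrite expr_div_n; lra.
have Fub := full_var_ub; have Flb := full_var_lb_large B16.
rewrite mulrC in Flb.
have := ratio_bounds _ _ k0 (ltW A0) z0 Flb Fub Clb Cub.
have -> : A / (B * (m / g) ^+ 2) = A / B * (g / m) ^+ 2.
  by field; rewrite !gt_eqF.
by apply => //; rewrite ?invr_ge0 ?invr_gt0.
Qed.

(** Here A - 1 and B - 1 are of order d / g^2, which makes F of order
    (d + m) / g^2 and C of order S / g^2. *)
Lemma var_ratio_wide (c : R) : 0 < c -> c <= m -> q <= 4^-1 -> m <= g ->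
  let S := m + d%:R * m ^+ 2 / g ^+ 2 in
  30^-1 / (6 + 2 / c) * ((d%:R + m) / S) <= F / C /\
  F / C <= 8 / (24 * 144)^-1 * ((d%:R + m) / S).
Proof.
move=> c0 cm q4 mg S.
have mgt0 : 0 < m by exact: lt_le_trans cm.
have d0 : 0 <= d%:R :> R by [].
have q0 : 0 <= q by rewrite divr_ge0// ltW.
have T0 : 0 <= q * m ^+ 2 by rewrite mulr_ge0// sqr_ge0.
have SE : S = m + q * m ^+ 2 by rewrite /S /q; ring.
have S0 : 0 < S by rewrite SE ltr_wpDr.
have k0 : 0 < 6 + 2 / c by rewrite addr_gt0// divr_gt0.
have A4 := full_excess_le_lin g1 q4; rewrite -/A -/q in A4.
have Bq : q / 24 <= B - 1 by apply: cond_excess_lb => //; lra.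
have BqA : B - 1 <= 4 / 3 * q by have := A_excess; lra.
have e2 := decay_ge_half mg.
have Sg : S / g ^+ 2 = m / g ^+ 2 + q * (m ^+ 2 / g ^+ 2) by rewrite SE; ring.
have dg : (d%:R + m) / g ^+ 2 = q + m / g ^+ 2 by rewrite /q; ring.
have mm0 : 0 <= m ^+ 2 / g ^+ 2 by rewrite divr_ge0 ?sqr_ge0.
have Flb : 30^-1 * ((d%:R + m) / g ^+ 2) <= F.
  have h := full_var_lb_small.
  have h2 : 0 <= (e ^+ 2 - 4^-1) * theta4 g m.
    rewrite mulr_ge0 ?subr_ge0//; apply: le_trans theta4_ge.
    by rewrite divr_ge0// mulr_ge0.
  rewrite dg; have := theta4_ge; lra.
have Fub : F <= 8 * ((d%:R + m) / g ^+ 2).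
  have h := full_var_ub_small; rewrite dg.
  have := theta4_le; have := delta_le; have := mg0; lra.
have Clb : (24 * 144)^-1 * (S / g ^+ 2) <= C.
  have h := cond_var_lb.
  have h2 : 0 <= (e ^+ 2 - 4^-1) * theta3 g m.
    rewrite mulr_ge0 ?subr_ge0//; apply: le_trans theta3_ge.
    by rewrite divr_ge0.
  have h3 : (m / (12 * g)) ^+ 2 = m ^+ 2 / g ^+ 2 / 144 by field; rewrite gt_eqF.
  have h4 := decay_gap_lb mg; rewrite h3 in h4.
  have h5 : 0 <= (B - 1) * ((1 - e) ^+ 2 - m ^+ 2 / g ^+ 2 / 144).
    by rewrite mulr_ge0 ?subr_ge0.
  have h6 : 0 <= (B - 1 - q / 24) * (m ^+ 2 / g ^+ 2 / 144).
    by rewrite mulr_ge0 ?subr_ge0// divr_ge0.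
  rewrite Sg; have := theta3_ge; have := mg0; lra.
have Cub : C <= (6 + 2 / c) * (S / g ^+ 2).
  have h := cond_var_ub_small.
  have h1 : m / g ^+ 2 <= m ^+ 2 / g ^+ 2 / c.
    rewrite ler_pdivlMr// mulrAC ler_wpM2r ?invr_ge0 ?(ltW g2_gt0)//.
    by rewrite expr2 ler_wpM2l.
  have c20 : 0 <= 2 / c by rewrite divr_ge0// ltW.
  have h2 : 0 <= (4 / 3 * q - (B - 1)) * (m ^+ 2 / g ^+ 2 / 4 + 2 * (m / g ^+ 2)).
    by apply: mulr_ge0; [rewrite subr_ge0|have := mg0; lra].
  have h3 : 0 <= q * (m ^+ 2 / g ^+ 2 / c - m / g ^+ 2).
    by apply: mulr_ge0; rewrite ?subr_ge0.
  have h4 : q * (m / g ^+ 2) <= 4^-1 * (m / g ^+ 2) by exact: ler_wpM2r.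
  have h5 : 0 <= 2 / c * (m / g ^+ 2) by exact: mulr_ge0.
  have h6 : 0 <= q * (m ^+ 2 / g ^+ 2) by exact: mulr_ge0.
  have h7 : 0 <= 2 / c * (q * (m ^+ 2 / g ^+ 2)) by exact: mulr_ge0.
  rewrite Sg; have := mg0; lra.
have w0 : 0 <= (d%:R + m) / g ^+ 2.
  by apply: divr_ge0; [exact: addr_ge0|exact: ltW].
have z0 : 0 < S / g ^+ 2 by exact: divr_gt0.
have := ratio_bounds _ _ k0 w0 z0 Flb Fub Clb Cub.
have -> : (d%:R + m) / g ^+ 2 / (S / g ^+ 2) = (d%:R + m) / S.
  by field; rewrite !gt_eqF.
by apply => //; rewrite ?invr_ge0 ?invr_gt0.
Qed.

(** The excess factor A is at most exp (2 c2), while B - 1 is bounded below in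
    terms of c1, so C is at least of order (m / g)^2. *)
Lemma var_ratio_critical (c1 c2 : R) : 0 < c1 -> c1 <= 24 -> c1 <= q -> q <= c2 ->
  0 < m -> m <= g ->
  F / C <= 6 * expR (2 * c2) / (c1 / 24 / 144) * (g / m) ^+ 2.
Proof.
move=> c10 c124 cq qc mgt0 mg.
have z0 : 0 < (m / g) ^+ 2 by apply: exprn_gt0; exact: divr_gt0.
have l0 : 0 < c1 / 24 / 144 by rewrite !divr_gt0.
have Bq : c1 / 24 <= B - 1 by apply: cond_excess_lb => //; exact: ltW.
have Clb : c1 / 24 / 144 * (m / g) ^+ 2 <= C.
  have h := decay_gap_lb mg.
  have h3 : (m / (12 * g)) ^+ 2 = (m / g) ^+ 2 / 144 by field; rewrite gt_eqF.
  rewrite h3 in h.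
  have h2 : 0 <= (B - 1) * ((1 - e) ^+ 2 - (m / g) ^+ 2 / 144).
    by apply: mulr_ge0; rewrite subr_ge0.
  have h4 : 0 <= (B - 1 - c1 / 24) * ((m / g) ^+ 2 / 144).
    by apply: mulr_ge0; [rewrite subr_ge0|exact: divr_ge0 (ltW z0) _].
  have := cond_var_lb0; lra.
have C0 : 0 < C by apply: lt_le_trans Clb; exact: mulr_gt0.
have Fub : F <= 6 * expR (2 * c2).
  apply: le_trans full_var_ub _; apply: ler_wpM2l => //.
  apply: le_trans (full_excess_le d g1) _.
  by rewrite ler_expR; apply: ler_wpM2l.
have -> : 6 * expR (2 * c2) / (c1 / 24 / 144) * (g / m) ^+ 2 =
    6 * expR (2 * c2) / (c1 / 24 / 144 * (m / g) ^+ 2).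
  by field; rewrite !gt_eqF.
rewrite ler_pdivrMr//; apply: le_trans Fub _.
rewrite -[leRHS]mulrA (mulrC _ C) mulrA ler_pdivlMr; last exact: mulr_gt0.
by apply: ler_wpM2l => //; apply: mulr_ge0 => //; exact: expR_ge0.
Qed.

End variance_bounds.
End estimates.

(** * Asymptotic regimes *)

Section asymptotics.
Context {R : realType}.
Implicit Types (f T V : nat -> R).

Lemma sqrt_bigO f T V (k : R) : 0 <= k ->
  (\forall n \near \oo, f n = Num.sqrt (V n)) ->
  (\forall n \near \oo, V n <= k * T n ^+ 2) ->
  f =O_\oo T.
Proof.
move=> k0 fV VT; apply/eqO_exP; exists (Num.sqrt k + 1).
  by rewrite ltr_wpDl// sqrtr_ge0.
near=> n.
have -> : f n = Num.sqrt (V n) by near: n.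
rewrite ger0_norm ?sqrtr_ge0//.
apply: (@le_trans _ _ (Num.sqrt k * `|T n|)); last first.
  by rewrite ler_wpM2r// lerDl.
rewrite -sqrtr_sqr -sqrtrM// ler_sqrt; last by rewrite mulr_ge0// sqr_ge0.
by near: n.
Unshelve. all: by end_near. Qed.

Lemma sqrt_bigTheta f T V (k1 k2 : R) : 0 < k1 -> 0 <= k2 ->
  (\forall n \near \oo, f n = Num.sqrt (V n)) ->
  (\forall n \near \oo, k1 * T n ^+ 2 <= V n /\ V n <= k2 * T n ^+ 2) ->
  f =Theta_\oo T.
Proof.
move=> k10 k20 fV VT; rewrite eqThetaE bigThetaE eqOmegaO; split.
  by apply: (sqrt_bigO k20 fV); apply: filterS VT => n [].
apply/eqO_exP; exists (Num.sqrt k1)^-1; first by rewrite invr_gt0 sqrtr_gt0.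
near=> n.
have -> : f n = Num.sqrt (V n) by near: n.
have [VT1 _] : k1 * T n ^+ 2 <= V n /\ V n <= k2 * T n ^+ 2 by near: n.
rewrite ler_pdivlMl ?sqrtr_gt0// (ger0_norm (sqrtr_ge0 _)).
rewrite -sqrtr_sqr -sqrtrM ?(ltW k10)// ler_sqrt//.
by apply: le_trans VT1; rewrite mulr_ge0 ?sqr_ge0// ltW.
Unshelve. all: by end_near. Qed.

(** Chosen so that the exponential of the asymptotic statements is an exact
    expression of the excess factors, see [excess_ratioE]. *)
Definition exponent_error (d : nat) (g : R) : R :=
  d%:R / 4 * ln (1 + 3 / (g * (g + 4))) - 3 * d%:R / (4 * g ^+ 2).

(** (g + 2)^2 cancels between the two factors, which leaves the ratio
    (g + 1) (g + 3) / (g (g + 4)) = 1 + 3 / (g (g + 4)) to the power d / 2. *)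
Lemma excess_ratioE (d : nat) (g : R) : 0 < g ->
  full_excess d g / cond_excess d g =
  expR (3 * d%:R / (4 * g ^+ 2) + exponent_error d g) ^+ 2.
Proof.
move=> g0; rewrite /exponent_error addrC subrK -expRM_natr.
have x0 : 0 < 1 + 3 / (g * (g + 4)).
  by rewrite addr_gt0// divr_gt0// mulr_gt0// addr_gt0.
have y0 : 0 < 1 + 1 / ((g + 1) * (g + 3)).
  by rewrite addr_gt0// divr_gt0// mulr_gt0// addr_gt0.
have z0 : 0 < 1 + 4 / (g * (g + 4)).
  by rewrite addr_gt0// divr_gt0// mulr_gt0// addr_gt0.
rewrite /full_excess /cond_excess -expr_div_n -sqrtrV ?(ltW y0)// -sqrtrM ?(ltW z0)//.
have -> : (1 + 4 / (g * (g + 4))) / (1 + 1 / ((g + 1) * (g + 3))) =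
    1 + 3 / (g * (g + 4)).
  field.
  by rewrite !gt_eqF ?addr_gt0 ?mulr_gt0 ?addr_gt0 //; nra.
have -> : Num.sqrt (1 + 3 / (g * (g + 4))) = expR (ln (1 + 3 / (g * (g + 4))) / 2).
  rewrite -[X in Num.sqrt X](@lnK R) ?posrE//.
  rewrite [X in expR X](_ : _ = ln (1 + 3 / (g * (g + 4))) / 2 * 2%:R); last by field.
  by rewrite expRM_natr sqrtr_sqr ger0_norm// expR_ge0.
by rewrite -expRM_natr; congr expR; field.
Qed.

(** ln (1 + t) = - ln (1 - t / (1 + t)) >= t / (1 + t) >= t - t^2. *)
Lemma ln1D_ge (t : R) : 0 <= t -> t - t ^+ 2 <= ln (1 + t).
Proof.
move=> t0; have t10 : 0 < 1 + t by rewrite ltr_wpDr.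
have : ln (1 + - (t / (1 + t))) <= - (t / (1 + t)).
  by apply: le_ln1Dx; rewrite ltrN2 ltr_pdivrMr// mul1r ltrDr.
have -> : 1 + - (t / (1 + t)) = (1 + t)^-1 by field; rewrite gt_eqF.
rewrite lnV ?posrE// lerN2; apply: le_trans.
rewrite ler_pdivlMr//.
have : 0 <= t * t * t by rewrite !mulr_ge0.
rewrite expr2; lra.
Qed.

Lemma exponent_error_le (d : nat) (g : R) : 1 <= g ->
  `|exponent_error d g| <= 6 / g * (d%:R / g ^+ 2).
Proof.
move=> g1; have g0 : 0 < g by exact: lt_le_trans g1.
have d0 : 0 <= d%:R :> R by [].
have x0 : 0 < g * (g + 4) by rewrite mulr_gt0// addr_gt0.
set x := (g * (g + 4))^-1.
have xp : 0 < x by rewrite invr_gt0.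
have xg : x <= (g ^+ 2)^-1.
  by rewrite lef_pV2 ?posrE ?exprn_gt0// expr2 ler_wpM2l ?(ltW g0)// lerDl.
have t0 : 0 <= 3 * x by rewrite mulr_ge0// ltW.
have l1 := ln1D_ge t0.
have l2 : ln (1 + 3 * x) <= 3 * x.
  by apply: le_ln1Dx; rewrite (lt_le_trans _ t0)// ltrN10.
pose w := (g ^+ 2)^-1; rewrite -/w in xg.
have w0 : 0 < w by rewrite invr_gt0 exprn_gt0.
have wg : w <= g^-1 by rewrite lef_pV2 ?posrE ?exprn_gt0// expr2 ler_peMl// ltW.
have gap : w - x <= 4 * (w / g).
  rewrite -subr_ge0 [X in 0 <= X](_ : _ = 16 * (w / g * (g + 4)^-1)); last first.
    by rewrite /w /x; field; rewrite !gt_eqF ?addr_gt0.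
  by rewrite !mulr_ge0 ?(ltW w0) ?invr_ge0 ?(ltW g0)// addr_ge0// ltW.
have xx : x ^+ 2 <= w / g.
  apply: (@le_trans _ _ (w * w)); last by rewrite ler_wpM2l// ltW.
  by rewrite expr2; apply: ler_pM => //; exact: ltW.
have -> : exponent_error d g = d%:R / 4 * (ln (1 + 3 * x) - 3 * w).
  by rewrite /exponent_error -/x /w; field; rewrite gt_eqF.
rewrite normrM (@ger0_norm _ (d%:R / 4)) ?divr_ge0//.
rewrite ler0_norm; last by lra.
have -> : 6 / g * (d%:R / g ^+ 2) = d%:R / 4 * (24 * (w / g)).
  by rewrite /w; field; rewrite gt_eqF.
apply: ler_wpM2l; first exact: divr_ge0.
move: l1; rewrite exprMn; lra.
Qed.

(** The square of a sum of two nonnegative numbers lies between the sum of their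
    squares and twice that sum; this is used for numerator and denominator. *)
Lemma wide_target (M D g : R) : 0 < M -> 0 <= D -> 0 < g ->
  let T := (M + Num.sqrt D) / (M + g^-1 * Num.sqrt D * M ^+ 2) in
  let S := M ^+ 2 + D * (M ^+ 2) ^+ 2 / g ^+ 2 in
  2^-1 * T ^+ 2 <= (D + M ^+ 2) / S /\ (D + M ^+ 2) / S <= 2 * T ^+ 2.
Proof.
move=> M0 D0 g0 T S.
have s0 := sqrtr_ge0 D; have sD := sqr_sqrtr D0.
set s := Num.sqrt D in s0 sD T *.
set r := g^-1 * s * M ^+ 2.
have r0 : 0 <= r.
  apply: mulr_ge0; last exact: sqr_ge0.
  by apply: mulr_ge0 => //; rewrite invr_ge0 ltW.
have SE : S = M ^+ 2 + r ^+ 2 by rewrite /S /r -sD; field; rewrite gt_eqF.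
have h1 : 0 <= M * s by rewrite mulr_ge0// ltW.
have h2 : 0 <= M * r by rewrite mulr_ge0// ltW.
have h3 : 0 <= (M - s) ^+ 2 by exact: sqr_ge0.
have h4 : 0 <= (M - r) ^+ 2 by exact: sqr_ge0.
have z0 : 0 < (M + r) ^+ 2 by rewrite exprn_gt0// ltr_wpDr.
have w0 : 0 <= (M + s) ^+ 2 by exact: sqr_ge0.
have := @ratio_bounds R 2^-1 1 2^-1 1 ((M + s) ^+ 2) ((M + r) ^+ 2) (D + M ^+ 2) S.
rewrite /T expr_div_n -/r divr1 div1r invrK; apply => //.
- by rewrite -sD; move: h1 h3; rewrite !expr2; lra.
- by rewrite -sD; move: h1 h3; rewrite !expr2; lra.
- by rewrite SE; move: h2 h4; rewrite !expr2; lra.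
- by rewrite SE; move: h2 h4; rewrite !expr2; lra.
Qed.

Lemma rho_MMD_sqrt (d : nat) (g : R) (mu : d.-tuple R)
    dO (Omega : measurableType dO) (Pr : probability Omega R)
    (X1 X2 Y1 Y2 : {RV Pr >-> d.-tuple R}) : 1 <= g ->
  is_mmd_sample (gaussian (zerot R d)) (gaussian mu) X1 X2 Y1 Y2 ->
  rho_MMD g X1 X2 Y1 Y2 =
  Num.sqrt (full_var d g (norm2 mu ^+ 2) / cond_var d g (norm2 mu ^+ 2)).
Proof.
move=> g1 hs; rewrite (rho_MMDE (lt_le_trans ltr01 g1) hs).
have m0 : 0 <= norm2 mu ^+ 2 by exact: sqr_ge0.
by rewrite sqrtrM ?full_var_ge0// sqrtrV// cond_var_ge0.
Qed.

End asymptotics.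

Theorem proposition19 (R : realType)
    (d : nat -> nat) (gamma : nat -> R) (mu : forall n : nat, (d n).-tuple R)
    (disp : nat -> measure_display)
    (Omega : forall n : nat, measurableType (disp n))
    (Pr : forall n : nat, probability (Omega n) R)
    (X1 X2 Y1 Y2 : forall n : nat, {RV (Pr n) >-> (d n).-tuple R}) :
  let D : nat -> R := fun n => (d n)%:R in
  let G : nat -> R := gamma in
  let M : nat -> R := fun n => norm2 (mu n) in
  let rho : nat -> R := fun n =>
    rho_MMD (gamma n) (X1 n) (X2 n) (Y1 n) (Y2 n) in
  (forall n : nat, 0 < gamma n) ->
  (forall n : nat,
     is_mmd_sample (gaussian (zerot R (d n))) (gaussian (mu n))
       (X1 n) (X2 n) (Y1 n) (Y2 n)) ->
  little_omega G (fun=> 1) ->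
  (fun n => M n ^+ 2) =Omega_\oo (fun=> 1) ->
  (G =o_\oo (fun n => M n ^+ 2) ->
   G =o_\oo (fun n => Num.sqrt (D n)) ->
   exists eps : nat -> R,
     eps =o_\oo (fun n => D n / G n ^+ 2) /\
     rho =Theta_\oo (fun n => expR (3 * D n / (4 * G n ^+ 2) + eps n)))
  /\
  (little_omega G (fun n => M n ^+ 2) ->
   (G =o_\oo (fun n => Num.sqrt (D n)) ->
    exists eps : nat -> R,
      eps =o_\oo (fun n => D n / G n ^+ 2) /\
      rho =Theta_\oo (fun n =>
        G n / M n ^+ 2 * expR (3 * D n / (4 * G n ^+ 2) + eps n))) /\
   (little_omega G (fun n => Num.sqrt (D n)) ->
    rho =Theta_\oo (fun n =>
      (M n + Num.sqrt (D n)) /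
      (M n + (G n)^-1 * Num.sqrt (D n) * M n ^+ 2))) /\
   (G =Theta_\oo (fun n => Num.sqrt (D n)) ->
    rho =O_\oo (fun n => Num.sqrt (D n) / M n ^+ 2))).
Proof.
move=> D G M rho gamma0 sample G_large M_large.
have G0 n : 0 < G n by exact: gamma0.
pose V n := full_var (d n) (G n) (M n ^+ 2) / cond_var (d n) (G n) (M n ^+ 2).
have G_ge (k : R) : \forall n \near \oo, k <= G n.
  have k1 : 0 < (`|k| + 1)^-1 by rewrite invr_gt0 ltr_wpDl.
  move/eqoP: G_large => /(_ _ k1); apply: filterS => n.
  rewrite normr1 ler_pdivlMl ?ltr_wpDl// mulr1 (gtr0_norm (G0 n)) => h.
  by have := ler_norm k; lra.
(* The constant of the hypothesis |mu|^2 = Omega (1). *)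
have [c c0 M_ge] : exists2 c, 0 < c & \forall n \near \oo, c <= M n ^+ 2.
  move: M_large; rewrite eqOmegaE eqOmegaO => /eqO_exP[k k0 kM].
  exists k^-1; first by rewrite invr_gt0.
  apply: filterS kM => n; rewrite normr1 ger0_norm ?sqr_ge0// => kM.
  by rewrite -[leLHS]mulr1 ler_pdivrMl.
(* The bounds on the variances hold for g >= 1, hence eventually. *)
have rhoE : \forall n \near \oo, rho n = Num.sqrt (V n).
  apply: filterS (G_ge 1) => n G1; exact: rho_MMD_sqrt.
have M2 n : 0 <= M n ^+ 2 by exact: sqr_ge0.
have D0 n : 0 <= D n by [].
pose eps n := exponent_error (d n) (G n).
have eps_o : eps =o_\oo (fun n => D n / G n ^+ 2).
  apply/eqoP => e e0; near=> n.
  have G1 : 1 <= G n by near: n; exact: G_ge.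
  apply: le_trans (exponent_error_le (d n) G1) _.
  rewrite ger0_norm; last by rewrite divr_ge0// exprn_ge0// ltW.
  rewrite ler_wpM2r//; first by rewrite divr_ge0// exprn_ge0// ltW.
  rewrite ler_pdivrMr ?G0// -ler_pdivrMl//.
  by near: n; exact: G_ge.
have dim_large (k : R) : 0 < k -> G =o_\oo (fun n => Num.sqrt (D n)) ->
    \forall n \near \oo, k <= D n / G n ^+ 2.
  move=> k0 GD; have sk : 0 < (Num.sqrt k)^-1 by rewrite invr_gt0 sqrtr_gt0.
  move/eqoP : GD => /(_ _ sk); apply: filterS => n.
  rewrite (gtr0_norm (G0 n)) (ger0_norm (sqrtr_ge0 _)) ler_pdivlMl ?sqrtr_gt0//.
  move=> h; rewrite ler_pdivlMr ?exprn_gt0 ?G0//.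
  have := @lerXn2r _ 2 (Num.sqrt k * G n) (Num.sqrt (D n)).
  rewrite !nnegrE mulr_ge0 ?sqrtr_ge0 ?(ltW (G0 n))// => /(_ isT isT h).
  by rewrite exprMn !sqr_sqrtr// ltW.
have big0 : 0 < 8 * 16 ^+ 2 :> R by rewrite mulr_gt0// exprn_gt0.
split=> [GM GD|GM].
  exists eps; split => //.
  (* e <= 1/2 as soon as m >= 6 g. *)
  have GM6 : \forall n \near \oo, 6 * G n <= M n ^+ 2.
    have s0 : 0 < 6^-1 :> R by rewrite invr_gt0.
    move/eqoP : GM => /(_ _ s0); apply: filterS => n.
    by rewrite (gtr0_norm (G0 n)) (ger0_norm (M2 n)) ler_pdivlMl.
  apply: (@sqrt_bigTheta _ _ _ V 4^-1 48) => //.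
  near=> n.
  have G1 : 1 <= G n by near: n; exact: G_ge.
  rewrite -excess_ratioE//; apply: var_ratio_far => //; near: n => //.
  exact: dim_large.
have GM1 : \forall n \near \oo, M n ^+ 2 <= G n.
  move/eqoP : GM => /(_ _ ltr01); apply: filterS => n.
  by rewrite mul1r (gtr0_norm (G0 n)) (ger0_norm (M2 n)).
split=> [GD|].
  exists eps; split => //.
  apply: (@sqrt_bigTheta _ _ _ V (2^-1 / (4^-1 + 2 / c)) (6 / (2 * 144)^-1)) => //.
    by rewrite divr_gt0 ?invr_gt0// addr_gt0 ?invr_gt0// divr_gt0.
  near=> n.
  have G1 : 1 <= G n by near: n; exact: G_ge.
  rewrite exprMn -excess_ratioE// [_ ^+ 2 * _]mulrC.
  apply: var_ratio_near => //; near: n => //.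
  exact: dim_large.
split=> [GD|GD].
  have D2 : \forall n \near \oo, Num.sqrt (D n) <= 2^-1 * G n.
    have s0 : 0 < 2^-1 :> R by rewrite invr_gt0.
    move/eqoP : GD => /(_ _ s0); apply: filterS => n.
    by rewrite (gtr0_norm (G0 n)) (ger0_norm (sqrtr_ge0 _)).
  apply: (@sqrt_bigTheta _ _ _ V (30^-1 / (6 + 2 / c) / 2)
    (8 / (24 * 144)^-1 * 2)) => //.
    by rewrite !divr_gt0 ?invr_gt0// addr_gt0// divr_gt0.
  near=> n.
  have G1 : 1 <= G n by near: n; exact: G_ge.
  have cM : c <= M n ^+ 2 by near: n.
  have MG : M n ^+ 2 <= G n by near: n.
  have q4 : D n / G n ^+ 2 <= 4^-1.
    rewrite ler_pdivrMr ?exprn_gt0 ?G0//.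
    have h : Num.sqrt (D n) <= 2^-1 * G n by near: n.
    have := @lerXn2r _ 2 (Num.sqrt (D n)) (2^-1 * G n).
    rewrite !nnegrE mulr_ge0 ?sqrtr_ge0 ?invr_ge0 ?(ltW (G0 n))// => /(_ isT isT h).
    rewrite exprMn sqr_sqrtr// => /le_trans; apply.
    apply: ler_wpM2r; first exact/exprn_ge0/ltW.
    by rewrite (_ : 2^-1 ^+ 2 = 4^-1)//; field.
  have M0 : 0 < M n.
    rewrite lt_neqAle sqrtr_ge0 andbT eq_sym; apply/eqP => M0.
    by move: cM; rewrite M0 expr0n /= leNgt c0.
  have [v1 v2] := var_ratio_wide G1 (M2 n) c0 cM q4 MG.
  have [t1 t2] := wide_target M0 (D0 n) (G0 n).
  split.
    apply: le_trans v1; rewrite -[leLHS]mulrA; apply: ler_wpM2l => //.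
    by rewrite divr_ge0 ?invr_ge0// addr_ge0// divr_ge0// ltW.
  apply: le_trans v2 _; rewrite -[leRHS]mulrA; apply: ler_wpM2l => //.
move: GD; rewrite eqThetaE bigThetaE eqOmegaO.
move=> -[/eqO_exP[k1 k10 GD] /eqO_exP[k2 k20 DG]].
have GD1 : \forall n \near \oo, G n <= k1 * Num.sqrt (D n).
  apply: filterS GD => n.
  by rewrite (gtr0_norm (G0 n)) (ger0_norm (sqrtr_ge0 _)).
have DG1 : \forall n \near \oo, Num.sqrt (D n) <= k2 * G n.
  apply: filterS DG => n.
  by rewrite (gtr0_norm (G0 n)) (ger0_norm (sqrtr_ge0 _)).
(* d / g^2 >= 1 / k1^2; the cap at 24 serves [cond_excess_lb]. *)
pose c1 := Num.min 24 (k1 ^+ 2)^-1.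
have c10 : 0 < c1 by rewrite lt_min invr_gt0 exprn_gt0// andbT.
pose K : R := 6 * expR (2 * k2 ^+ 2) / (c1 / 24 / 144).
have K0 : 0 <= K.
  by rewrite divr_ge0 ?mulr_ge0 ?expR_ge0// ?invr_ge0// ltW.
apply: (@sqrt_bigO _ _ _ V (K * k1 ^+ 2)) => //; first by rewrite mulr_ge0// sqr_ge0.
near=> n.
have G1 : 1 <= G n by near: n; exact: G_ge.
have cM : c <= M n ^+ 2 by near: n.
have MG : M n ^+ 2 <= G n by near: n.
have Mgt0 : 0 < M n ^+ 2 by exact: lt_le_trans cM.
have Gle : G n <= k1 * Num.sqrt (D n) by near: n.
have Dle : Num.sqrt (D n) <= k2 * G n by near: n.
have Gle2 : G n ^+ 2 <= k1 ^+ 2 * D n.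
  have := @lerXn2r _ 2 (G n) (k1 * Num.sqrt (D n)).
  rewrite !nnegrE mulr_ge0 ?sqrtr_ge0 ?(ltW k10) ?(ltW (G0 n))// => /(_ isT isT Gle).
  by rewrite exprMn sqr_sqrtr.
have Dle2 : D n <= k2 ^+ 2 * G n ^+ 2.
  have := @lerXn2r _ 2 (Num.sqrt (D n)) (k2 * G n).
  rewrite !nnegrE mulr_ge0 ?sqrtr_ge0 ?(ltW k20) ?(ltW (G0 n))// => /(_ isT isT Dle).
  by rewrite exprMn sqr_sqrtr.
have q1 : c1 <= D n / G n ^+ 2.
  apply: (@le_trans _ _ (k1 ^+ 2)^-1); first by rewrite ge_min lexx orbT.
  by rewrite ler_pdivlMr ?exprn_gt0 ?G0// ler_pdivrMl ?exprn_gt0.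
have q2 : D n / G n ^+ 2 <= k2 ^+ 2 by rewrite ler_pdivrMr ?exprn_gt0 ?G0.
have c124 : c1 <= 24 by rewrite ge_min lexx.
apply: le_trans (var_ratio_critical G1 (M2 n) c10 c124 q1 q2 Mgt0 MG) _.
rewrite -/K -[leRHS]mulrA; apply: ler_wpM2l => //.
rewrite expr_div_n [X in _ <= X](_ : _ = k1 ^+ 2 * D n / (M n ^+ 2) ^+ 2).
  by apply: ler_wpM2r => //; rewrite invr_ge0; exact: sqr_ge0.
by rewrite expr_div_n sqr_sqrtr// mulrA.
Unshelve. all: by end_near. Qed.
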